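(* Let $\Phi$ be an irreducible finite crystallographic root system of rank $n>1$, and let $\alpha,\alpha'\in\Phi_{\ge-1}$ satisfy $(\alpha\|\alpha')=(\alpha'\|\alpha)=1$. Then the set $E(\alpha,\alpha')=\{\sigma(\sigma^{-1}(\alpha)+\sigma^{-1}(\alpha')):\sigma\in\langle\tau_+,\tau_-\rangle\}$ consists of exactly two elements of $Q$, one of which is $\alpha+\alpha'$; denote the other by $\alpha\boxplus\alpha'$. In the special case $\alpha'=-\alpha_j$, $j\in I$, we have $(-\alpha_j)\boxplus\alpha=\tau_{-\varepsilon(j)}\bigl(-\alpha_j+\tau_{-\varepsilon(j)}(\alpha)\bigr)=\alpha-\alpha_j+\sum_{i\ne j}a_{ij}\alpha_i.$
   Context: $\Phi$ has simple roots $\Pi=\{\alpha_i:i\in I\}$, positive roots $\Phi_{>0}$, root lattice $Q=\mathbb{Z}\Pi$, ambient space $Q_\mathbb{R}$, Cartan matrix $(a_{ij})$ with $s_i(\alpha_j)=\alpha_j-a_{ij}\alpha_i$; $[\alpha:\alpha_i]$ is the coefficient of $\alpha_i$ in $\alpha$. $I=I_+\sqcup I_-$ is the bipartition of the tree Coxeter graph, and $\varepsilon(i)\in\{+,-\}$ is the sign with $i\in I_{\varepsilon(i)}$. For $\varepsilon=\pm$, $\tau_\varepsilon:Q_\mathbb{R}\to Q_\mathbb{R}$ is given by $[\tau_\varepsilon\alpha:\alpha_i]=-[\alpha:\alpha_i]-\sum_{j\ne i}a_{ij}\max([\alpha:\alpha_j],0)$ for $i\in I_\varepsilon$ and $[\tau_\varepsilon\alpha:\alpha_i]=[\alpha:\alpha_i]$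 otherwise; these are involutions and $\langle\tau_+,\tau_-\rangle$ is the group they generate. $\Phi_{\ge-1}=\Phi_{>0}\cup(-\Pi)$. The compatibility degree is the unique nonnegative-integer-valued function $(\alpha\|\beta)$ on $\Phi_{\ge-1}\times\Phi_{\ge-1}$ with $(-\alpha_i\|\alpha)=\max([\alpha:\alpha_i],0)$ for all $i,\alpha$ and $(\tau_\varepsilon\alpha\|\tau_\varepsilon\beta)=(\alpha\|\beta)$ for all $\alpha,\beta,\varepsilon$. *)

(* Defs.v *)
From mathcomp Require Import all_boot all_order all_algebra.

Set Implicit Arguments.
Unset Strict Implicit.
Unset Printing Implicit Defensive.

Import Order.TTheory GRing.Theory Num.Theory.
Local Open Scope ring_scope.

Section RootSystem.

Variables (R : realFieldType) (V : vectType R) (dot : {dot V for idfun}).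
Implicit Types (Phi : seq V) (a b v : V).

(* The pairing of v with the coroot of a. *)
Definition cartan_num a v : R := 2 * dot a v / dot a a.

Definition reflection a v : V := v - cartan_num a v *: a.

(* A finite reduced crystallographic root system in the Euclidean space V. The
   list Phi is only used through membership. *)
Record root_system Phi : Prop := RootSystem {
  roots_span : <<Phi>>%VS = fullv;
  roots_neq0 : 0 \notin Phi;
  roots_reduced : forall a c, a \in Phi -> c *: a \in Phi -> c = 1 \/ c = -1;
  roots_reflection : forall a b, a \in Phi -> b \in Phi ->
    reflection a b \in Phi;
  roots_crystallographic : forall a b, a \in Phi -> b \in Phi ->
    exists z : int, cartan_num a b = z%:~R
}.

Definition irreducible_roots Phi : Prop :=
  (exists a, a \in Phi) /\
  forall P : pred V,
    (forall a b, a \in Phi -> b \in Phi -> P a -> ~~ P b -> dot a b = 0) ->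
    {in Phi, forall a, P a} \/ {in Phi, forall a, ~~ P a}.

Section SimpleSystem.

Variables (n : nat) (Phi : seq V) (Pi : n.-tuple V).

Record simple_system : Prop := SimpleSystem {
  simple_basis : basis_of fullv Pi;
  simple_root : {subset Pi <= Phi};
  simple_decomposition : forall b, b \in Phi ->
    exists c : 'I_n -> nat,
      b = \sum_(i < n) Pi`_i *+ c i \/ b = - \sum_(i < n) Pi`_i *+ c i
}.

Definition positive_root b : Prop :=
  b \in Phi /\ forall i, 0 <= coord Pi i b.

(* The set of almost positive roots, the union of Phi_{>0} and -Pi. *)
Definition almost_positive b : Prop :=
  positive_root b \/ exists i : 'I_n, b = - Pi`_i.

Definition in_root_lattice v : Prop :=
  exists c : 'I_n -> int, v = \sum_(i < n) Pi`_i *~ c i.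

(* The convention is s_i(alpha_j) = alpha_j - a_ij alpha_i. *)
Definition cartan_mx : 'M[R]_n := \matrix_(i, j) cartan_num Pi`_i Pi`_j.

(* eps i = true encodes i \in I_+, and eps i = false encodes i \in I_-; an edge
   of the Coxeter graph joins i and j when i != j and a_ij != 0. *)
Definition bipartition (eps : 'I_n -> bool) : Prop :=
  forall i j, i != j -> cartan_mx i j != 0 -> eps i != eps j.

Variable eps : 'I_n -> bool.

Definition tau (e : bool) v : V :=
  \sum_(i < n) (if eps i == e
          then - coord Pi i v
               - \sum_(j < n | j != i) cartan_mx i j * Num.max (coord Pi j v) 0
          else coord Pi i v) *: Pi`_i.

(* Outside the almost positive roots the values of d are irrelevant. *)
Record compatibility_degree (d : V -> V -> nat) : Prop :=
  CompatibilityDegree {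
    compat_initial : forall (i : 'I_n) b, almost_positive b ->
      (d (- Pi`_i) b)%:R = Num.max (coord Pi i b) 0;
    compat_tau : forall a b e, almost_positive a -> almost_positive b ->
      d (tau e a) (tau e b) = d a b
  }.

End SimpleSystem.

End RootSystem.

(* The subgroup generated by the maps g i in the group of bijections of T (for
   g i bijective). *)
Inductive generated (T I : Type) (g : I -> T -> T) : (T -> T) -> Prop :=
| generated_gen i : generated g (g i)
| generated_id : generated g id
| generated_comp s t : generated g s -> generated g t -> generated g (s \o t)
| generated_inv s t :
    generated g s -> cancel s t -> cancel t s -> generated g t.

Section Boxplus.

Variables (R : realFieldType) (V : vectType R) (dot : {dot V for idfun}).
Variables (n : nat) (Pi : n.-tuple V) (eps : 'I_n -> bool).

(* E(a, a'); t stands for the inverse of s. *)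
Definition E_set (a a' x : V) : Prop :=
  exists s t : V -> V,
    [/\ generated (tau dot Pi eps) s, cancel s t, cancel t s
      & x = s (t a + t a')].

(* E(a, a') consists of exactly two elements of the root lattice, namely a + a'
   and b; at most one b satisfies this. *)
Definition is_boxplus (a a' b : V) : Prop :=
  [/\ b != a + a', in_root_lattice Pi (a + a'), in_root_lattice Pi b
    & forall x, E_set a a' x <-> x = a + a' \/ x = b].

End Boxplus.

(* Main.v *)
(** The group generated by the involutions tau_+, tau_- consists of alternating
    words; let a_t, a'_t be the images of a, a' under the word of length t.  Since
    tau_e is additive on (a_t, a'_t) unless one of the two is a negative simple
    root -alpha_j with e <> eps(j) (a "bad" step), the element of E(a, a') obtained
    at time t changes only at bad steps.

    There is a number H such that every word of length H acts as the linear map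
    induced by a diagram automorphism.  On almost positive roots this holds because
    all orbits of simple roots return to the negative simple roots after the same
    number of steps: in the mesh relation of the Auslander-Reiten quiver, the
    neighbours of a simple root with minimal return time are forced to become
    simple, and to return, simultaneously with it.  It extends to all vectors
    because every vector is a nonnegative combination of pairwise compatible almost
    positive roots, on which all alternating words are additive.

    Each almost positive root has exactly one bad step in any period of length H, so
    a and a' together have two, and E(a, a') has exactly two elements. *)
From HB Require Import structures.
From mathcomp Require Import all_boot all_order all_algebra fingroup perm.
From mathcomp Require Import ring lra zify.
Require Import Defs.

Set Implicit Arguments.
Unset Strict Implicit.
Unset Printing Implicit Defensive.

Import Order.TTheory GRing.Theory Num.Theory.
Local Open Scope ring_scope.

Lemma neq_negb (b b' : bool) : b != b' -> b = ~~ b'.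
Proof. by case: b b' => [] []. Qed.

(** * Alternating words in two maps *)

Section Alternate.

Variables (T : Type) (f : bool -> T -> T).

Fixpoint alternate (e : bool) (t : nat) (v : T) : T :=
  if t is t'.+1 then alternate (~~ e) t' (f e v) else v.

Lemma alternateD e s t v :
  alternate e (s + t) v = alternate (e (+) odd s) t (alternate e s v).
Proof.
elim: s e v => [|s IHs] e v /=; first by rewrite addbF.
by rewrite IHs addNb addbN.
Qed.

Lemma alternateS e t v :
  alternate e t.+1 v = f (e (+) odd t) (alternate e t v).
Proof. by rewrite -addn1 alternateD. Qed.

Lemma alternate_ind (P : T -> Prop) e t v :
  (forall e' u, P u -> P (f e' u)) -> P v -> P (alternate e t v).
Proof. by move=> Pf; elim: t e v => //= t IHt e v Pv; apply: IHt; exact: Pf. Qed.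

Hypothesis fK : forall e, involutive (f e).

(* The inverse of an alternating word of involutions is the reversed word, which
   starts with the last letter e + (t - 1). *)
Lemma alternateK e t :
  cancel (alternate e t) (alternate (e (+) ~~ odd t) t).
Proof.
move=> v; elim: t e v => [|t IHt] e v //.
have -> : e (+) ~~ odd t.+1 = ~~ e (+) ~~ odd t by rewrite /=; case: (e) (odd t) => [] [].
rewrite alternateS [alternate e t.+1 v]/= IHt.
by rewrite addNb addbN negbK addbK fK.
Qed.

Lemma alternateKV e t :
  cancel (alternate (e (+) ~~ odd t) t) (alternate e t).
Proof.
by move=> v; have := alternateK (e (+) ~~ odd t) t v; rewrite -addbA addbb addbF.
Qed.

Lemma alternate_inj e t : injective (alternate e t).
Proof. exact: can_inj (alternateK e t). Qed.

End Alternate.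

(** The shift [r] covers a map [h] that exchanges the two letters, as a diagram automorphism may
    do. *)
Lemma alternate_morph (S T : Type) (f : bool -> S -> S) (g : bool -> T -> T)
    (h : S -> T) (r e : bool) t v :
  (forall e' u, h (f e' u) = g (e' (+) r) (h u)) ->
  h (alternate f e t v) = alternate g (e (+) r) t (h v).
Proof. by move=> hf; elim: t e v => //= t IHt e v; rewrite IHt hf addNb. Qed.

(** * Inner products and Cartan numbers *)

Section DotForm.

Variables (R : realFieldType) (V : vectType R) (dot : {dot V for idfun}).
Implicit Types (a u v : V) (r : R).

Lemma dotC u v : dot u v = dot v u.
Proof. by rewrite hermC expr0 mul1r. Qed.

Lemma dotDl u v w : dot (u + v) w = dot u w + dot v w.
Proof. exact: linearDl. Qed.

Lemma dotZl r u w : dot (r *: u) w = r * dot u w.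
Proof. exact: linearZl_LR. Qed.

Lemma dotDr w u v : dot w (u + v) = dot w u + dot w v.
Proof. by rewrite !(dotC w) dotDl. Qed.

Lemma dotZr w r u : dot w (r *: u) = r * dot w u.
Proof. by rewrite !(dotC w) dotZl. Qed.

Lemma dotNl u w : dot (- u) w = - dot u w.
Proof. by rewrite -scaleN1r dotZl mulN1r. Qed.

Lemma dotNr w u : dot w (- u) = - dot w u.
Proof. by rewrite -scaleN1r dotZr mulN1r. Qed.

Lemma dot0r w : dot w 0 = 0.
Proof. by rewrite -(scale0r w) dotZr mul0r. Qed.

Lemma dot_sumr w I (r : seq I) (P : pred I) (F : I -> V) :
  dot w (\sum_(i <- r | P i) F i) = \sum_(i <- r | P i) dot w (F i).
Proof. exact: (big_morph _ (dotDr w) (dot0r w)). Qed.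

Lemma dot_suml w I (r : seq I) (P : pred I) (F : I -> V) :
  dot (\sum_(i <- r | P i) F i) w = \sum_(i <- r | P i) dot (F i) w.
Proof. by rewrite dotC dot_sumr; apply: eq_bigr => i _; rewrite dotC. Qed.

Lemma dot_gt0 u : u != 0 -> 0 < dot u u.
Proof. exact: neq0_dnorm_gt0. Qed.

Lemma dot_eq0 u : dot u u = 0 -> u = 0.
Proof.
by move=> u0; apply: contraTeq (lexx (dot u u)) => /dot_gt0; rewrite u0 ltxx.
Qed.

Lemma cartanD a u v :
  cartan_num dot a (u + v) = cartan_num dot a u + cartan_num dot a v.
Proof. by rewrite /cartan_num dotDr mulrDr mulrDl. Qed.

Lemma cartan0 a : cartan_num dot a 0 = 0.
Proof. by rewrite /cartan_num dot0r mulr0 mul0r. Qed.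

Lemma cartanZ a r u : cartan_num dot a (r *: u) = r * cartan_num dot a u.
Proof. by rewrite /cartan_num dotZr; ring. Qed.

Lemma cartan_sum a I (r : seq I) (P : pred I) (F : I -> V) :
  cartan_num dot a (\sum_(i <- r | P i) F i) =
  \sum_(i <- r | P i) cartan_num dot a (F i).
Proof. exact: (big_morph (cartan_num dot a) (cartanD a) (cartan0 a)). Qed.

Lemma cartan_dot a u : a != 0 -> cartan_num dot a u * dot a a = 2 * dot a u.
Proof. by move=> a0; rewrite /cartan_num divfK // gt_eqF ?dot_gt0. Qed.

Lemma cartan_diag a : a != 0 -> cartan_num dot a a = 2.
Proof. by move=> a0; rewrite /cartan_num mulfK // gt_eqF ?dot_gt0. Qed.

Lemma cartan_eq0 a u : a != 0 -> (cartan_num dot a u == 0) = (dot a u == 0).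
Proof.
move=> a0; rewrite /cartan_num mulf_eq0 invr_eq0 (gt_eqF (dot_gt0 a0)) orbF.
by rewrite mulf_eq0 pnatr_eq0.
Qed.

End DotForm.

(** * Simple reflections and coordinates *)

Section Roots.

Variables (R : realFieldType) (V : vectType R) (dot : {dot V for idfun}).
Variables (n : nat) (Phi : seq V) (Pi : n.-tuple V) (eps : 'I_n -> bool).
Hypotheses (hPhi : root_system dot Phi) (hPi : simple_system Phi Pi).
Hypothesis heps : bipartition dot Pi eps.
Implicit Types (u v g b : V) (i j k l : 'I_n) (J : {set 'I_n}) (e : bool).

Local Notation c i v := (coord Pi i v).
Local Notation al i := (Pi`_(nat_of_ord i)).
Local Notation ca i v := (cartan_num dot (al i) v).

Lemma Pi_free : free Pi.
Proof. exact: basis_free (simple_basis hPi). Qed.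

Lemma coordE (f : 'I_n -> R) k : c k (\sum_(i < n) f i *: al i) = f k.
Proof. exact: coord_sum_free Pi_free. Qed.

Lemma coord_sum_cond (P : pred 'I_n) (f : 'I_n -> R) k :
  c k (\sum_(i | P i) f i *: al i) = if P k then f k else 0.
Proof.
rewrite big_mkcond /=.
under eq_bigr => i _ do
  rewrite -[X in if _ then _ else X](scale0r (al i)) -(fun_if (fun r => r *: al i)).
exact: coordE.
Qed.

Lemma coordK v : v = \sum_(i < n) c i v *: al i.
Proof. by apply: coord_basis (simple_basis hPi) _; rewrite memvf. Qed.

Lemma coord_ext u v : (forall i, c i u = c i v) -> u = v.
Proof.
by move=> uv; rewrite (coordK u) (coordK v); apply: eq_bigr => i _; rewrite uv.
Qed.

Lemma coord_al i j : c j (al i) = (i == j)%:R.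
Proof. exact: coord_free Pi_free. Qed.

Lemma al_root i : al i \in Phi.
Proof. by apply: (simple_root hPi); rewrite mem_nth ?size_tuple. Qed.

Lemma root_neq0 b : b \in Phi -> b != 0.
Proof. by apply: contraTneq => ->; exact: roots_neq0 hPhi. Qed.

Lemma al_neq0 i : al i != 0.
Proof. exact: root_neq0 (al_root i). Qed.

Lemma al_inj i j : al i = al j -> i = j.
Proof.
move=> /(congr1 (fun v => c j v)); rewrite !coord_al eqxx.
by case: eqVneq => // _ /eqP; rewrite eq_sym oner_eq0.
Qed.

Lemma root_sign b :
  b \in Phi -> (forall i, 0 <= c i b) \/ (forall i, c i b <= 0).
Proof.
case/(simple_decomposition hPi) => m mb; have E i : c i (\sum_(k < n) al k *+ m k) = (m i)%:R.
  by under eq_bigr do rewrite -scaler_nat; rewrite coordE.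
by case: mb => ->; [left | right] => i; rewrite ?linearN /= E ?oppr_le0 ler0n.
Qed.

Lemma ca_coord i v : ca i v = \sum_(k < n) cartan_mx dot Pi i k * c k v.
Proof.
rewrite {1}(coordK v) cartan_sum; apply: eq_bigr => k _.
by rewrite cartanZ mxE mulrC.
Qed.

Lemma reflection_coord i k v :
  c k (reflection dot (al i) v) = c k v - (i == k)%:R * ca i v.
Proof. by rewrite /reflection linearB linearZ /= coord_al mulrC. Qed.

(** The reflection of [al k] in [al i] keeps coordinate 1 at [k], so it is positive, and its
    coordinate at [i] is minus the Cartan number. *)
Lemma cartan_le0 i k : i != k -> ca i (al k) <= 0.
Proof.
move=> ik; have := roots_reflection hPhi (al_root i) (al_root k).
case/root_sign => /[dup] /(_ i) + /(_ k);
  rewrite !reflection_coord !coord_al !eqxx mul1r (negbTE ik).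
  by rewrite eq_sym (negbTE ik) sub0r oppr_ge0.
by rewrite mul0r subr0 ler10.
Qed.

Lemma dot_al_same i k : i != k -> eps i = eps k -> dot (al i) (al k) = 0.
Proof.
move=> ik ek; apply/eqP; rewrite -cartan_eq0 ?al_neq0 //.
have := heps ik; rewrite mxE ek eqxx; case: eqP => // _ H.
by have := H isT.
Qed.

Lemma ca_same i k : i != k -> eps i = eps k -> ca i (al k) = 0.
Proof. by move=> ik ek; rewrite /cartan_num dot_al_same // mulr0 mul0r. Qed.

(** The product of the commuting simple reflections at the vertices of [J] with sign [e], written as
    one sum because these simple roots are orthogonal. *)
Definition trefl J e v : V :=
  v - \sum_(i | (i \in J) && (eps i == e)) ca i v *: al i.

Lemma trefl_is_linear J e : linear (trefl J e).
Proof.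
move=> r u v; rewrite /trefl scalerBr scaler_sumr addrACA -opprD -big_split /=.
by congr (_ - _); apply: eq_bigr => i _; rewrite cartanD cartanZ scalerDl scalerA.
Qed.
HB.instance Definition _ J e :=
  GRing.isLinear.Build R V V _ (trefl J e) (trefl_is_linear J e).

Lemma trefl_coord J e v k : c k (trefl J e v) =
  if (k \in J) && (eps k == e) then c k v - ca k v else c k v.
Proof.
rewrite /trefl linearB /= (coord_sum_cond (fun i => (i \in J) && (eps i == e))).
by case: ifP => _; rewrite ?subr0.
Qed.

Lemma trefl_ca J e v k : k \in J -> eps k = e -> ca k (trefl J e v) = - ca k v.
Proof.
move=> kJ ek; rewrite /trefl -scaleN1r cartanD cartanZ cartan_sum.
rewrite (bigD1 k) ?kJ ?ek ?eqxx //= big1 ?addr0 => [|i /andP[/andP[_ /eqP ei] ik]].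
  by rewrite cartanZ cartan_diag ?al_neq0 //; ring.
by rewrite cartanZ ca_same ?mulr0 // ?ei // eq_sym.
Qed.

Lemma treflK J e : involutive (trefl J e).
Proof.
move=> v; apply: coord_ext => k; rewrite trefl_coord; case: ifP => kJ; rewrite trefl_coord kJ //.
by case/andP: kJ => kJ /eqP ek; rewrite trefl_ca //; ring.
Qed.

Lemma trefl_root J e v : v \in Phi -> trefl J e v \in Phi.
Proof.
move=> vP; rewrite /trefl -big_filter.
have : all (fun i => eps i == e) [seq i <- index_enum _ | (i \in J) && (eps i == e)].
  by apply/allP => i; rewrite mem_filter => /andP[/andP[]].
have : uniq [seq i <- index_enum _ | (i \in J) && (eps i == e)].
  by rewrite filter_uniq ?index_enum_uniq.
elim: [seq i <- _ | _] => [|i s IHs] /=; first by rewrite big_nil subr0.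
case/andP=> is_ us /andP[/eqP ei es]; rewrite big_cons.
have i0 : ca i (\sum_(k <- s) ca k v *: al k) = 0.
  rewrite cartan_sum big_seq big1 // => k ks.
  rewrite cartanZ ca_same ?mulr0 //; first by apply: contraNneq is_ => ->.
  by rewrite ei (eqP (allP es _ ks)).
have := roots_reflection hPhi (al_root i) (IHs us es); rewrite /reflection.
rewrite -[X in v + X]scaleN1r cartanD cartanZ i0 mulr0 addr0 scaleN1r.
by rewrite opprD addrA addrAC.
Qed.

Lemma trefl_dot J e u v : dot (trefl J e u) (trefl J e v) = dot u v.
Proof.
suff key x y : dot (trefl J e x) y = dot x (trefl J e y) by rewrite key treflK.
rewrite /trefl dotDl dotDr dotNl dotNr dot_suml dot_sumr; congr (_ - _).
apply: eq_bigr => i _; rewrite dotZl dotZr /cartan_num (dotC _ x).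
by ring.
Qed.

(** * The maps tau on almost positive roots *)

Definition nonneg v : bool := [forall i, 0 <= c i v].

Definition supported J v : Prop := forall i, i \notin J -> c i v = 0.

Lemma nonnegP v : reflect (forall i, 0 <= c i v) (nonneg v).
Proof. exact: forallP. Qed.

Lemma nonneg_al i : nonneg (al i).
Proof. by apply/nonnegP => k; rewrite coord_al ler0n. Qed.

Lemma nonneg_opp_al i : nonneg (- al i) = false.
Proof.
apply/negbTE/forallPn; exists i.
by rewrite linearN /= coord_al eqxx oppr_ge0 -ltNge ltr01.
Qed.

(* On vectors supported in J this is tau for the parabolic subsystem of J; for
   J = setT it is tau itself. *)
Definition tauJ J e v : V :=
  \sum_(i < n) (if (i \in J) && (eps i == e)
    then - c i v - \sum_(j < n | j != i) cartan_mx dot Pi i j * Num.max (c j v) 0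
    else c i v) *: al i.

Lemma tauJ_coord J e v k : c k (tauJ J e v) =
  if (k \in J) && (eps k == e)
  then - c k v - \sum_(j < n | j != k) cartan_mx dot Pi k j * Num.max (c j v) 0
  else c k v.
Proof. by rewrite /tauJ coordE. Qed.

Lemma tau_setT e v : tau dot Pi eps e v = tauJ setT e v.
Proof. by apply: eq_bigr => i _; rewrite in_setT. Qed.

(** The update at [k] reads only coordinates of neighbours, which have the other sign and do not
    move. *)
Lemma tauJK J e : involutive (tauJ J e).
Proof.
move=> v; apply: coord_ext => k; rewrite tauJ_coord; case: ifP => kJ; last by rewrite tauJ_coord kJ.
case/andP: (kJ) => _ /eqP ek; rewrite [X in - X - _]tauJ_coord kJ.
suff -> : \sum_(j < n | j != k) cartan_mx dot Pi k j * Num.max (c j (tauJ J e v)) 0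
        = \sum_(j < n | j != k) cartan_mx dot Pi k j * Num.max (c j v) 0 by ring.
apply: eq_bigr => j jk.
have [->|akj] := eqVneq (cartan_mx dot Pi k j) 0; first by rewrite !mul0r.
have ej : eps j != e by rewrite -ek eq_sym (heps _ akj) // eq_sym.
by rewrite tauJ_coord (negbTE ej) andbF.
Qed.

Lemma ca_split k v :
  ca k v = 2 * c k v + \sum_(j < n | j != k) cartan_mx dot Pi k j * c j v.
Proof. by rewrite ca_coord (bigD1 k) //= mxE cartan_diag ?al_neq0. Qed.

Lemma tauJ_nonneg J e v : nonneg v -> tauJ J e v = trefl J e v.
Proof.
move/nonnegP=> v0; apply: coord_ext => k; rewrite tauJ_coord trefl_coord.
case: ifP => // _; rewrite ca_split.
rewrite (eq_bigr (fun j => cartan_mx dot Pi k j * c j v)) => [|j _]; first by ring.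
by rewrite max_l.
Qed.

Lemma tauJ_supp J e v : supported J v -> supported J (tauJ J e v).
Proof. by move=> sv i iJ; rewrite tauJ_coord (negbTE iJ) /= sv. Qed.

Lemma tauJ_opp_al J e i :
  tauJ J e (- al i) = if (i \in J) && (eps i == e) then al i else - al i.
Proof.
apply: coord_ext => k; rewrite tauJ_coord big1 => [|j _]; last first.
  by rewrite linearN /= coord_al max_r ?mulr0 // oppr_le0 ler0n.
rewrite subr0 [c k (if _ then _ else _)](fun_if (coord Pi k)) linearN /= coord_al opprK.
by have [<-//|_] := eqVneq i k; rewrite oppr0 !if_same.
Qed.

(* The positive, resp. almost positive, roots of the parabolic subsystem of J. *)
Definition posr J g : Prop := [/\ g \in Phi, nonneg g & supported J g].

Definition apos J g : Prop := posr J g \/ exists2 i, i \in J & g = - al i.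

Lemma posr_al J i : i \in J -> posr J (al i).
Proof.
move=> iJ; split; [exact: al_root | exact: nonneg_al | move=> k kJ].
by rewrite coord_al; case: eqVneq kJ => // <-; rewrite iJ.
Qed.

Lemma posr_gt0 J g : posr J g -> exists2 i, i \in J & 0 < c i g.
Proof.
case=> gP /nonnegP g0 gJ; have : [exists i, c i g != 0].
  apply: contraTT (root_neq0 gP) => /existsPn H; rewrite negbK; apply/eqP.
  by apply: coord_ext => i; rewrite linear0; apply/eqP; rewrite -[_ == _]negbK.
case/existsP => i gi; exists i; last by rewrite lt_neqAle eq_sym gi g0.
by apply: contraNT gi => /gJ ->.
Qed.

(** Reflecting in a simple root of the support negates that coordinate and moves no other; a root
    has coordinates of one sign, so the others vanish, and reducedness leaves the factor 1. *)
Lemma posr_indep J e g : posr J g ->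
  (forall k, eps k != e -> c k g = 0) -> exists i, [/\ i \in J, eps i = e & g = al i].
Proof.
move=> gJ ge; have [i iJ gi] := posr_gt0 gJ.
have ei : eps i = e by apply: contraTeq gi => /ge ->; rewrite ltxx.
have cai : ca i g = 2 * c i g.
  rewrite ca_split big1 ?addr0 // => k ki.
  have [ek|/ge->] := eqVneq (eps k) e; last by rewrite mulr0.
  by rewrite mxE ca_same ?mul0r ?ei // eq_sym.
case: gJ => gP /nonnegP g0 _.
have gE : g = c i g *: al i.
  apply: coord_ext => k; rewrite linearZ /= coord_al.
  have [<-|ik] := eqVneq i k; first by rewrite mulr1.
  have := roots_reflection hPhi (al_root i) gP.
  case/root_sign => H; first by have := H i; rewrite reflection_coord eqxx cai mul1r; lra.
  by have := H k; rewrite reflection_coord (negbTE ik) mul0r; have := g0 k; rewrite mulr0; lra.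
exists i; split=> //; move: gP; rewrite gE => /(roots_reduced hPhi (al_root i)).
by case=> E; [rewrite E scale1r | move: gi; rewrite E oppr_gt0 ltr10].
Qed.

Variant tau_spec J e g : V -> Prop :=
| TauPos of posr J g & posr J (trefl J e g) : tau_spec J e g (trefl J e g)
| TauSimple i of i \in J & eps i = e & g = al i : tau_spec J e g (- al i)
| TauOpp i of i \in J & eps i = e & g = - al i : tau_spec J e g (al i)
| TauFix i of i \in J & eps i = ~~ e & g = - al i : tau_spec J e g g.

(** If the reflected root is not positive, its coordinates are all nonpositive; those of sign other
    than [e] did not move and so vanish, and [posr_indep] makes [g] simple. *)
Lemma tauP J e g : apos J g -> tau_spec J e g (tauJ J e g).
Proof.
case=> [gJ|[i iJ gi]]; last first.
  rewrite gi tauJ_opp_al iJ /=; case: eqP => ei; first exact: TauOpp iJ ei erefl.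
  by apply: TauFix iJ _ erefl; case: (eps i) (e) ei => [] [].
have [gP g0 gs] := gJ; rewrite tauJ_nonneg //.
have sg : supported J (trefl J e g) by rewrite -tauJ_nonneg //; exact: tauJ_supp.
case: (root_sign (trefl_root J e gP)) => H.
  by apply: TauPos => //; split=> //; [exact: trefl_root | apply/nonnegP].
have [k ek|i [iJ ei gi]] := posr_indep (e := e) gJ.
  apply/eqP; rewrite eq_le (nonnegP _ g0) andbT.
  by have := H k; rewrite trefl_coord (negbTE ek) andbF.
have E : tauJ J e (al i) = - al i.
  by apply: (can_inj (tauJK J e)); rewrite tauJK tauJ_opp_al iJ ei eqxx.
by rewrite -tauJ_nonneg // gi E; apply: TauSimple iJ ei erefl.
Qed.

Lemma apos_tau J e g : apos J g -> apos J (tauJ J e g).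
Proof.
move=> gJ; case: (tauP e gJ) => [||i iJ _ _|] //; first by left.
- by move=> i iJ _ _; right; exists i.
- by left; apply: posr_al.
Qed.

Lemma iter_linear_sum (f : {linear V -> V}) N I (r : seq I) (a : I -> R) (x : I -> V) :
  iter N f (\sum_(i <- r) a i *: x i) = \sum_(i <- r) a i *: iter N f (x i).
Proof.
elim: N => //= N ->; rewrite linear_sum; apply: eq_bigr => i _.
by rewrite linearZ.
Qed.

(** The map permutes the finite spanning set of roots; [N] is the order of this permutation. *)
Lemma root_perm_finite_order (f : {linear V -> V}) :
  injective f -> {in Phi, forall g, f g \in Phi} ->
  exists2 N, (0 < N)%N & forall v, iter N f v = v.
Proof.
move=> f_inj fP; pose f' (x : seq_sub Phi) := SeqSub (fP _ (valP x)).
have f'_inj : injective f' by move=> x y [] /f_inj /val_inj.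
exists #[perm f'_inj]%g => [|v]; first exact: order_gt0.
rewrite [v]coordK iter_linear_sum; apply: eq_bigr => i _; congr (_ *: _).
have iter_val N (x : seq_sub Phi) : val (iter N (perm f'_inj) x) = iter N f (val x).
  by elim: N => //= N IHN; rewrite permE /= IHN.
rewrite -[al i]/(val (SeqSub (al_root i))) -iter_val -permX expg_order perm1.
by [].
Qed.

(* The orbit sum of v under the Coxeter element t_- t_+, added to its image under
   t_+, is fixed by all simple reflections, hence zero. *)
Lemma alternate_leaves_nonneg J e v : supported J v -> v != 0 ->
  exists t, ~~ nonneg (alternate (tauJ J) e t v).
Proof.
move=> vJ; pose C := trefl J (~~ e) \o trefl J e.
have [N N0 CN] : exists2 N, (0 < N)%N & forall v, iter N C v = v.
  apply: root_perm_finite_order => [|g gP]; last by rewrite /= !trefl_root.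
  exact: (inj_comp (can_inj (treflK J _)) (can_inj (treflK J _))).
case: (boolP [exists t : 'I_N.*2.+1, ~~ nonneg (alternate (tauJ J) e t v)]).
  by case/existsP => t Ht _; exists t.
move/existsPn => all_nn; case/eqP.
have nn t : (t <= N.*2)%N -> nonneg (alternate (trefl J) e t v) /\
    alternate (tauJ J) e t v = alternate (trefl J) e t v.
  elim: t => [|t IHt] tN; first by have := all_nn ord0; rewrite negbK.
  have [nt Et] := IHt (ltnW tN).
  have E : alternate (tauJ J) e t.+1 v = alternate (trefl J) e t.+1 v.
    by rewrite !alternateS Et tauJ_nonneg.
  by split=> //; rewrite -E; have := all_nn (@Ordinal N.*2.+1 t.+1 tN); rewrite negbK.
have altC s : alternate (trefl J) e s.*2 v = iter s C v.
  by elim: s => // s IHs; rewrite doubleS !alternateS /= odd_double IHs addbF addbT.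
have altCS s : alternate (trefl J) e s.*2.+1 v = trefl J e (iter s C v).
  by rewrite alternateS odd_double addbF altC.
pose z := \sum_(s < N) iter s C v; pose u := z + trefl J e z.
(* Applying [C] shifts the summation index, and the period [N] closes the cycle. *)
have Cz : C z = z.
  have -> : C z = \sum_(s < N) iter s.+1 C v.
    by rewrite -[C z]/(trefl J (~~ e) (trefl J e z)) !linear_sum.
  rewrite /z; case: (N) N0 CN => // N' _ CN'.
  by rewrite big_ord_recr big_ord_recl /= -!iterS CN' addrC.
have tu : trefl J e u = u by rewrite /u linearD /= treflK addrC.
have tu' : trefl J (~~ e) u = u.
  rewrite /u linearD /= -[trefl J (~~ e) (trefl J e z)]/(C z) Cz.
  by rewrite -{1}Cz /C /= treflK addrC.
have ca0 i : i \in J -> ca i u = 0.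
  move=> iJ; have [ei|ei] := eqVneq (eps i) e.
    have := congr1 (fun v => c i v) tu; rewrite trefl_coord iJ ei eqxx /=; lra.
  have ei' : eps i = ~~ e by case: (eps i) (e) ei => [] [].
  have := congr1 (fun v => c i v) tu'; rewrite trefl_coord iJ ei' eqxx /=; lra.
have sC s : supported J (iter s C v).
  by move=> i iJ; elim: s => [|s IHs]; rewrite ?vJ //= !trefl_coord (negbTE iJ).
have sz : supported J z by move=> i iJ; rewrite linear_sum big1 // => s _; exact: sC.
have u0 : u = 0.
  apply: (dot_eq0 (dot := dot)); rewrite {1}(coordK u) dot_suml big1 // => i _.
  have [iJ|iJ] := boolP (i \in J).
    by have /eqP := ca0 i iJ; rewrite cartan_eq0 ?al_neq0 // dotZl => /eqP ->; rewrite mulr0.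
  by rewrite dotZl linearD /= trefl_coord (negbTE iJ) sz ?addr0 ?mul0r.
apply: coord_ext => i; rewrite linear0; have := congr1 (fun v => c i v) u0.
rewrite linear0 linearD /= /z !linear_sum /=.
have pos (s : 'I_N) : 0 <= c i (iter s C v).
  by rewrite -altC (nonnegP _ (proj1 (nn _ _))) // leq_double ltnW.
have pos' (s : 'I_N) : 0 <= c i (trefl J e (iter s C v)).
  by rewrite -altCS (nonnegP _ (proj1 (nn _ _))) // ltn_double.
(* All summands of [z] are nonnegative at [i], so each vanishes there; the summand at [s = 0] is [v]
   itself. *)
move/eqP; rewrite paddr_eq0 ?sumr_ge0 // => /andP[+ _].
rewrite psumr_eq0 // => /allP /(_ (Ordinal N0)) /=.
by rewrite mem_index_enum => /(_ isT) /eqP.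
Qed.

Lemma apos_alternate J e t g : apos J g -> apos J (alternate (tauJ J) e t g).
Proof. by apply: alternate_ind => e' u; exact: apos_tau. Qed.

Lemma apos_nonneg J g : apos J g -> nonneg g -> posr J g.
Proof. by case=> // -[i _ ->]; rewrite nonneg_opp_al. Qed.

(** At the least time where nonnegativity fails, the step just made must have sent a simple root to
    its negative. *)
Lemma posr_exit J e g : posr J g -> exists t i,
  [/\ forall s, (s <= t)%N -> posr J (alternate (tauJ J) e s g),
      i \in J, eps i = e (+) odd t & alternate (tauJ J) e t g = al i].
Proof.
move=> gJ; have [gP g0 gs] := gJ.
case: (ex_minnP (alternate_leaves_nonneg e gs (root_neq0 gP))) => -[|t]; first by rewrite /= g0.
move=> neg tmin; have pos s : (s <= t)%N -> posr J (alternate (tauJ J) e s g).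
  move=> st; apply: apos_nonneg; first by apply: apos_alternate; left.
  by apply: contraT => /tmin; rewrite ltnNge st.
exists t; move: neg; rewrite alternateS.
have [|||] := tauP (e (+) odd t) (or_introl (pos t (leqnn t))).
- by move=> _ [_ ->].
- by move=> i iJ ei gi _; exists i.
- by move=> i iJ ei gi; rewrite nonneg_al.
- by move=> i _ _ gi; have [_] := pos t (leqnn t); rewrite gi nonneg_opp_al.
Qed.

(** * Compatible roots and cluster expansions *)

Definition part e v : V := \sum_(i < n | eps i == e) c i v *: al i.

Lemma part_split e v : v = part e v + part (~~ e) v.
Proof.
rewrite {1}(coordK v) (bigID (fun i => eps i == e)) /=; congr (_ + _).
by apply: eq_bigl => i; case: (eps i) (e) => [] [].
Qed.

Lemma part_al e i : part e (al i) = if eps i == e then al i else 0.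
Proof.
rewrite /part; case: ifP => ei; last first.
  rewrite big1 // => k /eqP ek; rewrite coord_al.
  by have [ik|_] := eqVneq i k; [rewrite ik ek eqxx in ei | rewrite scale0r].
rewrite (bigD1 i) //= coord_al eqxx scale1r big1 ?addr0 // => k /andP[_ ki].
by rewrite coord_al eq_sym (negbTE ki) scale0r.
Qed.

Lemma dot_al_part e i v : eps i = e ->
  dot (al i) v = dot (al i) (al i) * c i v + dot (al i) (part (~~ e) v).
Proof.
move=> ei; rewrite [in LHS](part_split e v) dotDr; congr (_ + _).
rewrite dot_sumr (bigD1 i) ?ei //= dotZr mulrC big1 ?addr0 // => k /andP[/eqP ek ki].
by rewrite dotZr dot_al_same ?mulr0 ?ek // eq_sym.
Qed.

(* (dot u v + skew u v) / 2 and (dot u v - skew u v) / 2 are the Euler forms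
   of the two bipartite orientations. *)
Definition skew u v : R :=
  dot (part true u) (part false v) - dot (part false u) (part true v).

Lemma skewE e u v : `|skew u v| =
  `|dot (part e u) (part (~~ e) v) - dot (part (~~ e) u) (part e v)|.
Proof. by case: e => //; rewrite distrC. Qed.

Lemma skewC u v : `|skew u v| = `|skew v u|.
Proof. by rewrite /skew distrC (dotC _ (part true v)) (dotC _ (part false v)). Qed.

(** The reflection negates [skew], up to a symmetric correction [S] that cancels in the difference;
    the absolute value hides the sign. *)
Lemma trefl_skew J e u v : supported J u -> supported J v ->
  `|skew (trefl J e u) (trefl J e v)| = `|skew u v|.
Proof.
move=> uJ vJ; rewrite !(skewE e).
have other w : part (~~ e) (trefl J e w) = part (~~ e) w.
  apply: eq_bigr => i ei; rewrite trefl_coord.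
  by have /negbTE -> : eps i != e; [case: (eps i) (e) ei => [] [] | rewrite andbF].
pose S x y := \sum_(i | (i \in J) && (eps i == e))
  ca i (part (~~ e) x) * dot (al i) (part (~~ e) y).
have SC x y : S x y = S y x.
  by apply: eq_bigr => i _; rewrite /cartan_num; ring.
have same x y : supported J x ->
    dot (part e (trefl J e x)) (part (~~ e) y) = - dot (part e x) (part (~~ e) y) - S x y.
  move=> xJ; rewrite !dot_suml.
  have -> : S x y = \sum_(i | eps i == e)
      if i \in J then ca i (part (~~ e) x) * dot (al i) (part (~~ e) y) else 0.
    by rewrite /S -big_mkcondl /=; apply: eq_bigl => i; rewrite andbC.
  rewrite -sumrN -sumrB; apply: eq_bigr => i /eqP ei; rewrite !dotZl trefl_coord ei eqxx andbT.
  case: ifP => [iJ|/negbT /xJ ->]; last by rewrite !mul0r oppr0 addr0.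
  have -> : ca i x = 2 * c i x + ca i (part (~~ e) x).
    rewrite {1}/cartan_num (dot_al_part x ei) /cartan_num.
    by field; rewrite gt_eqF // dot_gt0 ?al_neq0.
  by ring.
rewrite !other same // !(dotC _ (part (~~ e) u)) same // SC; move: (S _ _) => s.
by rewrite -normrN; congr (`|_|); ring.
Qed.

(** Multiplied by the squared length of [al i], the two inequalities on the right become the two
    halves of the absolute value bound. *)
Lemma compat_al J e i v : i \in J -> eps i = e ->
  (`|skew (al i) v| <= dot (al i) v) = (0 <= c i v) && (c i (trefl J e v) <= 0).
Proof.
move=> iJ ei; rewrite (skewE e) !part_al ei eqxx.
have -> : (e == ~~ e) = false by case: (e).
rewrite (dotC _ 0) dot0r subr0 (dot_al_part v ei) trefl_coord iJ ei eqxx /= ler_norml.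
have D0 := dot_gt0 dot (al_neq0 i); have := cartan_dot dot v (al_neq0 i).
rewrite (dot_al_part v ei); move: (ca i v) (dot _ (part _ _)) D0 (c i v).
move: (dot _ _) => D r x D0 y rD; apply/andP/andP => -[H1 H2]; split.
- by rewrite -(pmulr_rge0 _ D0); lra.
- by rewrite -(pmulr_rle0 _ D0) mulrBr (mulrC D r) rD; lra.
- move: H2; rewrite -(pmulr_rle0 _ D0) mulrBr (mulrC D r) rD; lra.
- by have := mulr_ge0 (ltW D0) H1; lra.
Qed.

(* The vanishing of the compatibility degree, by a formula that does not refer to
   a parabolic subsystem J and is nevertheless preserved by every tauJ J e. *)
Definition compatible g b : Prop :=
  [/\ forall i, g = - al i -> c i b <= 0, forall i, b = - al i -> c i g <= 0
    & nonneg g -> nonneg b -> `|skew g b| <= dot g b].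

Lemma compatible_sym g b : compatible g b -> compatible b g.
Proof. by case=> H1 H2 H3; split=> // ? ?; rewrite skewC dotC; apply: H3. Qed.

Lemma compatible_tau_opp J e g b i : apos J g -> apos J b -> compatible g b ->
  tauJ J e g = - al i -> c i (tauJ J e b) <= 0.
Proof.
move=> gJ bJ [H1 H2 H3]; case: (tauP e gJ) => [_ [_ + _] E|k kJ ek gk|k _ _ _ E|k kJ ek gk].
- by rewrite E nonneg_opp_al.
- move=> /oppr_inj /al_inj <-; case: bJ => [[bP b0 bs]|[l lJ bl]].
    rewrite tauJ_nonneg //; move: H3; rewrite gk nonneg_al b0 (compat_al _ kJ ek).
    by move=> /(_ isT isT) /andP[].
  have := H2 l bl; rewrite gk coord_al bl tauJ_opp_al.
  have [->|kl] := eqVneq k l; first by rewrite ler10.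
  by case: ifP => _ _; rewrite ?linearN /= coord_al eq_sym (negbTE kl) ?oppr0 ?mulr0n lexx.
- by have := nonneg_al k; rewrite E nonneg_opp_al.
- rewrite {1}gk => /oppr_inj /al_inj <-; rewrite tauJ_coord ek.
  have -> : (~~ e == e) = false by case: (e).
  by rewrite andbF; apply: H1.
Qed.

Lemma compatible_tau_al J e b i : i \in J -> eps i = e -> compatible (- al i) b ->
  nonneg (tauJ J e b) -> `|skew (al i) (tauJ J e b)| <= dot (al i) (tauJ J e b).
Proof.
move=> iJ ei [H _ _] b0; rewrite (compat_al _ iJ ei) (nonnegP _ b0) /=.
by rewrite -tauJ_nonneg // tauJK; exact: H.
Qed.

(** If both images are nonnegative, either both roots are reflected and the inequality is invariant,
    or one image is a simple root coming from its negative, where [compatible_tau_al] applies. *)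
Lemma compatible_tau J e g b : apos J g -> apos J b -> compatible g b ->
  compatible (tauJ J e g) (tauJ J e b).
Proof.
move=> gJ bJ gb; split=> [i|i|].
- exact: compatible_tau_opp.
- exact: compatible_tau_opp (compatible_sym gb).
case: (tauP e gJ) => [[gP g0 gs] _|i _ _ _|i iJ ei gi _|i _ _ ->];
  rewrite ?nonneg_opp_al //; last first.
  by move=> tb; apply: (compatible_tau_al iJ ei _ tb); rewrite -gi.
move=> tg; case: (tauP e bJ) => [[bP b0 bs] _ _|i _ _ _|i iJ ei bi _|i _ _ ->];
  rewrite ?nonneg_opp_al //.
  by rewrite trefl_skew // trefl_dot; case: gb => _ _; apply.
rewrite skewC dotC -tauJ_nonneg //; apply: compatible_tau_al iJ ei _ _.
  by rewrite -bi; exact: compatible_sym.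
by rewrite tauJ_nonneg.
Qed.

Definition combination (s : seq (R * V)) : V := \sum_(p <- s) p.1 *: p.2.

Definition cluster J (s : seq (R * V)) : Prop :=
  (forall p, p \in s -> 0 <= p.1 /\ apos J p.2) /\
  (forall p q, p \in s -> q \in s -> compatible p.2 q.2).

Definition map_cluster (f : V -> V) (s : seq (R * V)) := [seq (p.1, f p.2) | p <- s].

Lemma cluster_tau J e s : cluster J s -> cluster J (map_cluster (tauJ J e) s).
Proof.
case=> H1 H2; split=> [p /mapP[q /H1 [q0 qJ] ->]|p q /mapP[p' p's ->] /mapP[q' q's ->]].
  by split=> //; exact: apos_tau.
by apply: compatible_tau; [case: (H1 _ p's) | case: (H1 _ q's) | exact: H2].
Qed.

Lemma apos_coord_ge0 J g i : apos J g -> g != - al i -> 0 <= c i g.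
Proof.
case=> [[_ /nonnegP //]|[k _ ->]]; rewrite linearN /= coord_al.
by have [->|_] := eqVneq k i; rewrite ?eqxx // oppr0.
Qed.

Lemma combination_coord s k : c k (combination s) = \sum_(p <- s) p.1 * c k p.2.
Proof. by rewrite linear_sum; apply: eq_bigr => p _; rewrite linearZ. Qed.

(** Nonlinearity enters only through positive parts. For each [j], either [- al j] is in the cluster
    and all [j]-coordinates are nonpositive, or all are nonnegative; in both cases the positive part
    is additive. *)
Lemma tau_combination J e s : cluster J s ->
  tauJ J e (combination s) = combination (map_cluster (tauJ J e) s).
Proof.
case=> H1 H2; apply: coord_ext => k.
have coh j : Num.max (c j (combination s)) 0 = \sum_(p <- s) p.1 * Num.max (c j p.2) 0.
  rewrite combination_coord.
  have [/hasP[p ps /eqP pj]|/hasPn nj] := boolP (has (fun p => p.2 == - al j) s).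
    have le0 q : q \in s -> c j q.2 <= 0 by move=> qs; have [+ _ _] := H2 p q ps qs; apply.
    rewrite max_r; last first.
      rewrite big_seq; apply: sumr_le0 => q qs.
      by rewrite mulr_ge0_le0 ?le0 //; case: (H1 _ qs).
    by rewrite big_seq big1 // => q qs; rewrite (max_r (le0 q qs)) mulr0.
  have ge0 q : q \in s -> 0 <= c j q.2.
    by move=> qs; exact: (apos_coord_ge0 (proj2 (H1 _ qs)) (nj q qs)).
  rewrite max_l; last first.
    rewrite big_seq; apply: sumr_ge0 => q qs.
    by rewrite mulr_ge0 ?ge0 //; case: (H1 _ qs).
  by rewrite !big_seq; apply: eq_bigr => q qs; rewrite (max_l (ge0 q qs)).
rewrite tauJ_coord [RHS]combination_coord /map_cluster big_map /=.
under [RHS]eq_bigr do rewrite tauJ_coord.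
case: ifP => _; last by rewrite combination_coord.
rewrite combination_coord (eq_bigr (fun j => \sum_(p <- s)
  p.1 * (cartan_mx dot Pi k j * Num.max (c j p.2) 0))); last first.
  by move=> j _; rewrite coh big_distrr; apply: eq_bigr => p _ /=; rewrite mulrCA.
rewrite exchange_big /= -sumrN -sumrB; apply: eq_bigr => p _.
by rewrite mulrBr mulrN mulr_sumr.
Qed.

Lemma alternate_combination J e t s : cluster J s ->
  alternate (tauJ J) e t (combination s) =
    combination (map_cluster (alternate (tauJ J) e t) s) /\
  cluster J (map_cluster (alternate (tauJ J) e t) s).
Proof.
elim: t e s => [|t IHt] e s sJ.
  by rewrite /map_cluster (eq_map (_ : _ =1 id)) ?map_id // => -[].
have := IHt (~~ e) _ (cluster_tau e sJ).
by rewrite -tau_combination // /map_cluster -map_comp.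
Qed.

Lemma apos_sub J J' g : J' \subset J -> apos J' g -> apos J g.
Proof.
move=> /subsetP sJ [[gP g0 gs]|[i iJ ->]]; last by right; exists i; rewrite ?sJ.
by left; split=> // i iJ; apply: gs; apply: contra iJ => /sJ.
Qed.

(* Evolve v under tauJ until some coordinate in J becomes negative, split off the
   nonpositive coordinates as multiples of negative simple roots, and expand the
   rest in a smaller parabolic subsystem. *)
Lemma cluster_expansion J v : supported J v ->
  exists2 s, cluster J s & v = combination s.
Proof.
elim: {J}_.+1 {-2}J (ltnSn #|J|) v => // m IHm J Jm v vJ.
have [->|v0] := eqVneq v 0.
  by exists [::]; [split | rewrite /combination big_nil].
have [t] := alternate_leaves_nonneg true vJ v0.
set w := alternate _ _ _ v => /forallPn[i]; rewrite -ltNge => wi.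
(* The reversed word is additive on clusters, so it carries an expansion of [w] back to one of
   [v]. *)
suff [s sJ ws] : exists2 s, cluster J s & w = combination s.
  have := alternate_combination (true (+) ~~ odd t) t sJ.
  rewrite -ws alternateK => [[-> sJ']|e]; last exact: tauJK.
  by exists (map_cluster (alternate (tauJ J) (true (+) ~~ odd t) t) s).
have wJ : supported J w by apply: (alternate_ind (P := supported J)) => // e u; exact: tauJ_supp.
pose J' := [set k in J | 0 < c k w].
have sJ' : J' \subset J by apply/subsetP => k; rewrite inE => /andP[].
have ltJ' : (#|J'| < m)%N.
  rewrite -ltnS (leq_trans _ Jm) // ltnS proper_card // properE sJ' /=.
  apply/subsetPn; exists i; last by rewrite inE ltNge (ltW wi) andbF.
  by apply: contraLR wi => /wJ ->; rewrite ltxx.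
pose w' := \sum_(k < n) (if k \in J' then c k w else 0) *: al k.
have [|s [s1 s2] w's] := IHm J' ltJ' w'.
  by move=> k kJ; rewrite coordE (negbTE kJ).
have sk k p : k \notin J' -> p \in s -> c k p.2 = 0.
  move=> kJ /s1[_ [[_ _ ->//]|[l lJ ->]]]; rewrite linearN /= coord_al.
  by have [lk|_] := eqVneq l k; [rewrite lk (negbTE kJ) in lJ | rewrite oppr0].
(* On [J :\: J'] the coordinates of [w] are at most 0, so these weights are nonnegative. Almost
   positive roots of [J'] have coordinate 0 there, which makes them compatible with these negative
   simple roots. *)
pose s' := [seq (- c k w, - al k) | k <- enum (J :\: J')].
have s'P p : p \in s' -> exists k, [/\ k \in J, k \notin J' & p = (- c k w, - al k)].
  by case/mapP => k; rewrite mem_enum inE => /andP[kJ' kJ] ->; exists k.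
exists (s' ++ s); last first.
  rewrite /combination big_cat -[\sum_(p <- s) _]w's big_map big_enum /=.
  apply: coord_ext => k; rewrite linearD /= coordE.
  under eq_bigr do rewrite scaleNr scalerN opprK.
  rewrite (coord_sum_cond (fun l => l \in J :\: J')).
  rewrite inE; have [kJ'|] := boolP (k \in J'); rewrite ?add0r //=.
  by have [|/wJ ->] := boolP (k \in J); rewrite addr0.
split=> [p|p q]; rewrite !mem_cat => /orP[].
- case/s'P => k [kJ kJ' ->] /=; split; last by right; exists k.
  by move: kJ'; rewrite inE kJ /= -leNgt oppr_ge0.
- by case/s1 => ? /(apos_sub sJ').
- case/s'P => k [kJ kJ' ->] /= /orP[/s'P[l [lJ lJ' ->]]|qs] /=.
    by split=> [j _|j _|]; rewrite ?nonneg_opp_al // linearN /= coord_al oppr_le0 ler0n.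
  split=> [j /oppr_inj/al_inj <-|j _|]; rewrite ?nonneg_opp_al ?(sk _ _ _ qs) //.
  by rewrite linearN /= coord_al oppr_le0 ler0n.
- move=> ps /orP[/s'P[l [lJ lJ' ->]]|qs] /=; last exact: s2.
  apply: compatible_sym; split=> [j /oppr_inj/al_inj <-|j _|];
    rewrite ?nonneg_opp_al ?(sk _ _ _ ps) //.
  by rewrite linearN /= coord_al oppr_le0 ler0n.
Qed.

(** * The half turn *)

Lemma root_opp b : b \in Phi -> - b \in Phi.
Proof.
move=> bP; have := roots_reflection hPhi bP bP.
by rewrite /reflection cartan_diag ?root_neq0 // scaler_nat mulr2n opprD addrA subrr sub0r.
Qed.

Lemma root_height_lt b : b \in Phi -> exists m : nat, \sum_i c i b < m%:R.
Proof.
case/(simple_decomposition hPi) => f fb; exists (\sum_i f i).+1.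
rewrite -natr1 natr_sum ltr_pwDr ?ltr01 //; apply: ler_sum => i _.
have E : c i (\sum_(k < n) al k *+ f k) = (f i)%:R.
  by under eq_bigr do rewrite -scaler_nat; rewrite coordE.
case: fb => ->; rewrite ?linearN /= E //.
by rewrite (le_trans (y := 0)) ?oppr_le0 ?ler0n.
Qed.

(* Reflecting in the simple roots of S lowers the height without changing the
   coordinates outside S, so a root with mixed support would descend forever. *)
Lemma root_connected (S : pred 'I_n) b : b \in Phi -> nonneg b ->
  (forall i j, S i -> ~~ S j -> dot (al i) (al j) = 0) ->
  (forall i, S i -> c i b = 0) \/ (forall i, ~~ S i -> c i b = 0).
Proof.
move=> bP b0 orth; have [m] := root_height_lt bP.
elim: m b bP b0 => [|m IHm] b bP b0 hb.
  by move: hb; rewrite ltNge sumr_ge0 // => i _; exact: (nonnegP _ b0).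
have [/existsP[k /andP[kS bk]]|/existsPn nk] :=
  boolP [exists k, ~~ S k && (c k b != 0)]; last first.
  by right=> i iS; apply/eqP; have := nk i; rewrite iS negbK.
left; pose bS := \sum_(i | S i) c i b *: al i.
have bSE i : c i bS = if S i then c i b else 0.
  exact: coord_sum_cond.
have [bS0|bSn0] := eqVneq bS 0.
  by move=> i iS; have := bSE i; rewrite iS bS0 linear0.
have dS i : S i -> dot (al i) b = dot (al i) bS.
  move=> iS; rewrite [in LHS](coordK b) !dot_sumr (bigID S) /= [X in _ + X]big1 ?addr0 // => l lS.
  by rewrite dotZr orth ?mulr0.
(* The product of [bS] with itself is positive, and its coefficients are nonnegative, so some simple
   root of [S] has positive product with [bS], hence with [b]. *)
have [i /andP[iS bi]] : exists i, S i && (0 < dot (al i) b).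
  apply/existsP; apply: contraTT (dot_gt0 dot bSn0) => /existsPn H.
  rewrite -leNgt {1}/bS dot_suml; apply: sumr_le0 => i iS.
  rewrite dotZl mulr_ge0_le0 ?(nonnegP _ b0) // -dS //.
  by have := H i; rewrite iS -leNgt.
have ca_gt0 : 0 < ca i b by rewrite /cartan_num divr_gt0 ?mulr_gt0 ?dot_gt0 ?al_neq0 ?ltr0n.
have ca_ge1 : 1 <= ca i b.
  have [z E] := roots_crystallographic hPhi (al_root i) bP.
  by move: ca_gt0; rewrite E ltr0z ler1z.
have rP := roots_reflection hPhi (al_root i) bP.
have ik : i != k by apply: contraNneq kS => <-.
have rk : c k (reflection dot (al i) b) = c k b.
  by rewrite reflection_coord (negbTE ik) mul0r subr0.
have bk0 : 0 < c k b by rewrite lt_neqAle eq_sym bk (nonnegP _ b0).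
have r0 : nonneg (reflection dot (al i) b).
  case: (root_sign rP) => [/nonnegP //|/(_ k)].
  by rewrite rk leNgt bk0.
have [|H|H] := IHm _ rP r0.
- have -> : \sum_l c l (reflection dot (al i) b) = \sum_l c l b - ca i b.
    rewrite (bigD1 i) //= [in RHS](bigD1 i) //= reflection_coord eqxx mul1r addrAC.
    congr (_ - _); congr (_ + _); apply: eq_bigr => l li.
    by rewrite reflection_coord eq_sym (negbTE li) mul0r subr0.
  by move: hb; rewrite -natr1; lra.
(* A reflected root without coordinates in [S] would be orthogonal to [al i], and then so would
   [b]. *)
- have : dot (al i) (reflection dot (al i) b) = 0.
    rewrite (coordK (reflection _ _ _)) dot_sumr big1 // => l _; rewrite dotZr.
    by have [/H ->|lS] := boolP (S l); rewrite ?mul0r // orth ?mulr0.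
  move/eqP; rewrite -(cartan_eq0 dot) ?al_neq0 // /reflection -scaleN1r.
  rewrite cartanD !cartanZ cartan_diag ?al_neq0 //.
  by move/eqP; lra.
- by have := bk0; rewrite -rk H ?ltxx.
Qed.

Hypothesis hirr : irreducible_roots dot Phi.

(** Irreducibility is applied to the set of roots supported on [S]: by [root_connected] every other
    root is supported off [S], hence orthogonal to them. *)
Lemma simple_connected (S : pred 'I_n) i0 : S i0 ->
  (forall i j, S i -> ~~ S j -> dot (al i) (al j) = 0) -> forall i, S i.
Proof.
move=> Si0 orth; pose P v := [forall i, ~~ S i ==> (c i v == 0)].
have [|H i|H] := (proj2 hirr) P; last first.
- have := H _ (al_root i0); rewrite negb_forall => /existsP[i].
  rewrite negb_imply coord_al => /andP[iS].
  by have [ii|_] := eqVneq i0 i; [rewrite -ii Si0 in iS | rewrite eqxx].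
- have /forallP/(_ i) := H _ (al_root i); rewrite coord_al eqxx oner_eq0 implybF.
  by rewrite negbK.
move=> u v uP vP Pu Pv.
have vS i : S i -> c i v = 0.
  move=> iS; have half w : w \in Phi -> nonneg w -> ~~ P w -> c i w = 0.
    move=> wP w0 Pw; have [H|H] := root_connected wP w0 orth; first exact: H.
    by case/negP: Pw; apply/forallP => l; apply/implyP => /H ->.
  case: (root_sign vP) => [/nonnegP v0|v0]; first exact: half.
  apply/eqP; rewrite -oppr_eq0 -linearN /=; apply/eqP; apply: half.
  - exact: root_opp.
  - by apply/nonnegP => l; rewrite linearN /= oppr_ge0 v0.
  - apply: contra Pv => /forallP Pv; apply/forallP => l.
    by have := Pv l; rewrite linearN /= oppr_eq0.
rewrite (coordK u) dot_suml big1 // => i _; rewrite (coordK v) dot_sumr big1 // => j _.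
rewrite dotZl dotZr; have [iS|iS] := boolP (S i); last first.
  by have /forallP/(_ i) := Pu; rewrite iS => /eqP ->; rewrite mul0r.
have [/vS ->|jS] := boolP (S j); first by rewrite mul0r mulr0.
by rewrite orth // !mulr0.
Qed.

(** * Orbits of simple roots and their return times *)

Local Notation evol := (alternate (tauJ setT)).

Lemma supported_setT v : supported setT v.
Proof. by move=> i; rewrite in_setT. Qed.

(* A simple root al i, entering at the step that follows tau_(eps i), is last
   positive after t steps, as al k. *)
Definition exits i t k : Prop :=
  [/\ forall s, (s <= t)%N -> posr setT (evol (~~ eps i) s (al i)),
      eps k = ~~ eps i (+) odd t & evol (~~ eps i) t (al i) = al k].

Lemma exits_exist i : exists p : nat * 'I_n, exits i p.1 p.2.
Proof.
have [t [k [pos _ ek E]]] := posr_exit (~~ eps i) (posr_al (in_setT i)).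
by exists (t, k).
Qed.

Lemma tauJ_al e k : eps k = e -> tauJ setT e (al k) = - al k.
Proof.
by move=> ek; apply: (can_inj (tauJK setT e)); rewrite tauJK tauJ_opp_al in_setT ek eqxx.
Qed.

Lemma trefl_al e k : eps k = e -> trefl setT e (al k) = - al k.
Proof. by move=> ek; rewrite -tauJ_nonneg ?nonneg_al // tauJ_al. Qed.

Lemma trefl_al_other e k : eps k = ~~ e ->
  trefl setT e (al k) = al k - \sum_(l < n | l != k) cartan_mx dot Pi l k *: al l.
Proof.
move=> ek; rewrite /trefl [in RHS](bigID (fun l => eps l == e)) /= [X in _ = _ - (_ + X)]big1.
  rewrite addr0; congr (_ - _); apply: eq_big => [l|l _]; last by rewrite mxE.
  by rewrite in_setT /=; have [->|//] := eqVneq l k; rewrite ek; case: (e).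
move=> l /andP[lk le]; rewrite mxE ca_same ?scale0r // ek.
by case: (eps l) (e) le => [] [].
Qed.

(** The bound [t.+1] exceeds that of the hypothesis by one because the step leaving a positive root
    is still linear. *)
Lemma alternate_pos_linear e t g :
  (forall s, (s <= t)%N -> posr setT (evol e s g)) ->
  forall s, (s <= t.+1)%N -> evol e s g = alternate (trefl setT) e s g.
Proof.
move=> pos; elim=> // s IHs st; rewrite !alternateS -IHs 1?ltnW //.
by rewrite tauJ_nonneg //; case: (pos s st).
Qed.

Lemma alternate_trefl_sum e t (I : finType) (P : pred I) (a : I -> R) (x : I -> V) :
  alternate (trefl setT) e t (\sum_(i | P i) a i *: x i) =
  \sum_(i | P i) a i *: alternate (trefl setT) e t (x i).
Proof.
elim: t e x => // t IHt e x /=; rewrite linear_sum /= -IHt; congr (alternate _ _ _ _).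
by apply: eq_bigr => i _; rewrite linearZ.
Qed.

Lemma alternate_treflB e t u v : alternate (trefl setT) e t (u - v) =
  alternate (trefl setT) e t u - alternate (trefl setT) e t v.
Proof. by elim: t e u v => //= t IHt e u v; rewrite linearB IHt. Qed.

(* The mesh relation of the Auslander-Reiten quiver, at the moment when the orbit
   of al i is about to leave the positive roots. *)
Lemma mesh_relation i t k : exits i t k ->
  \sum_(j < n | j != i) cartan_mx dot Pi j i *: alternate (trefl setT) (eps i) t (al j)
  = \sum_(l < n | l != k) cartan_mx dot Pi l k *: al l.
Proof.
case=> pos ek Ek; have Lk := alternate_pos_linear pos.
case: t => [|t] in pos ek Ek Lk *.
  (* [t = 0] would force [k = i], against the opposite signs. *)
  by move: ek; rewrite -(al_inj Ek) addbF; case: (eps i).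
have At : evol (~~ eps i) t (al i) = trefl setT (~~ eps k) (al k).
  have := Lk t.+1 (leqnSn _); rewrite Ek [in RHS]alternateS -Lk 1?ltnW // => ->.
  by rewrite ek /= addbN negbK treflK.
rewrite -alternate_trefl_sum.
(* The word is applied to each term of this difference. The reflected term continues the orbit of
   [al i] to [- al k]; the term [al i] first becomes [- al i] and then runs one step behind the
   orbit. *)
have -> : \sum_(j < n | j != i) cartan_mx dot Pi j i *: al j = al i - trefl setT (~~ eps i) (al i).
  by rewrite trefl_al_other ?negbK // opprB addrC subrK.
rewrite alternate_treflB.
have -> : alternate (trefl setT) (eps i) t.+1 (trefl setT (~~ eps i) (al i)) = - al k.
  have <- : alternate (trefl setT) (~~ eps i) t.+2 (al i) = - al k.
    by rewrite alternateS -(Lk t.+1) // Ek -ek trefl_al.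
  by rewrite -{1}[eps i]negbK.
rewrite [alternate _ _ t.+1 _]/= trefl_al // -[X in alternate _ _ _ X]sub0r alternate_treflB.
rewrite -Lk 1?ltnW // At trefl_al_other ?negbK //.
have -> : alternate (trefl setT) (~~ eps i) t 0 = 0.
  by rewrite -[X in alternate _ _ _ X](subrr 0) alternate_treflB subrr.
by rewrite opprK sub0r opprB subrK.
Qed.

Variables (len : 'I_n -> nat) (star : 'I_n -> 'I_n).
Hypothesis exitsP : forall i, exits i (len i) (star i).

(* The right-hand side of the mesh relation is supported on pairwise orthogonal
   simple roots, so each positive root on the left is simple. *)
Lemma neighbor_exit i j : j != i -> cartan_mx dot Pi j i != 0 ->
    (forall l, l != i -> cartan_mx dot Pi l i != 0 -> (len i <= len l)%N) ->
  len j = len i /\ alternate (trefl setT) (eps i) (len i) (al j) = al (star j).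
Proof.
move=> ji aji len_min; have mesh := mesh_relation (exitsP i).
have [_ ek _] := exitsP i.
have opp l : l != i -> cartan_mx dot Pi l i != 0 -> ~~ eps l = eps i.
  by move=> li /(heps li); case: (eps l) (eps i) => [] [].
have pos l : l != i -> cartan_mx dot Pi l i != 0 ->
    posr setT (alternate (trefl setT) (eps i) (len i) (al l)).
  move=> li ali; have [posl _ _] := exitsP l; have := len_min l li ali => ll.
  by rewrite -(opp l) // -(alternate_pos_linear posl (leqW ll)); exact: posl.
(* At coordinate [m] the right-hand side of the mesh relation is zero, since distinct vertices of
   equal sign are orthogonal. The terms on the left all have one sign, so each vanishes. *)
have coord0 m : eps m = eps (star i) ->
    c m (alternate (trefl setT) (eps i) (len i) (al j)) = 0.
  move=> em; pose F l := - (cartan_mx dot Pi l i *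
    c m (alternate (trefl setT) (eps i) (len i) (al l))).
  have F0 : \sum_(l < n | l != i) F l = 0.
    have := congr1 (fun v => c m v) mesh; rewrite sumrN !linear_sum /=.
    under eq_bigr do rewrite linearZ.
    move=> ->; rewrite big1 ?oppr0 // => l lk; rewrite linearZ /= coord_al.
    have [lm|_] := eqVneq l m; last by rewrite mulr0.
    by rewrite mxE ca_same ?mul0r // lm.
  have Fge0 l : l != i -> 0 <= F l.
    move=> li; rewrite /F -mulNr; have [->|ali] := eqVneq (cartan_mx dot Pi l i) 0.
      by rewrite oppr0 mul0r.
    rewrite mulr_ge0 ?oppr_ge0 //; first by rewrite mxE cartan_le0.
    by have [_ /nonnegP H _] := pos l li ali; exact: H.
  move/eqP: F0; rewrite psumr_eq0 // => /allP /(_ j (mem_index_enum j)).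
  by rewrite ji /= oppr_eq0 mulf_eq0 (negbTE aji) => /eqP.
have [m em|l [_ el Bl]] := posr_indep (e := ~~ eps (star i)) (pos j ji aji).
  by apply: coord0; case: (eps m) (eps (star i)) em => [] [].
have [posj ekj Ej] := exitsP j; have ij := len_min j ji aji.
have El : evol (~~ eps j) (len i) (al j) = al l.
  by rewrite (alternate_pos_linear posj (leqW ij)) (opp j).
(* If the orbit of [al j] stayed positive longer, its next image would be [- al l]. *)
have lenj : len j = len i.
  apply/eqP; rewrite eqn_leq ij andbT leqNgt; apply/negP => lt.
  have [_] := posj _ lt; rewrite alternateS El tauJ_al ?nonneg_opp_al //.
  by rewrite el ek (opp j) // !addNb negbK.
by split=> //; rewrite Bl -El -lenj.
Qed.

Hypothesis n_gt0 : (0 < n)%N.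

(** By [neighbor_exit] the vertices of least [len] are closed under adjacency, so connectedness
    applies. *)
Lemma len_const i j : len i = len j.
Proof.
have [i0 _ len_min] := arg_minnP len (erefl (xpredT (Ordinal n_gt0))).
suff H l : len l = len i0 by rewrite !H.
apply/eqP; move: l; apply: (simple_connected (S := fun l => len l == len i0) (i0 := i0)) => //.
move=> l m /eqP li mi; have ml : m != l by apply: contraNneq mi => ->; rewrite li.
apply/eqP; apply: contraNT mi => lm0; rewrite -li.
have aml : cartan_mx dot Pi m l != 0 by rewrite mxE cartan_eq0 ?al_neq0 // dotC.
have [k _ _|-> //] := neighbor_exit ml aml; by rewrite li len_min.
Qed.

(** Three steps beyond [len]: one from [- al i] to [al i], one from [al (star i)] to its negative,
    and one fixing a negative simple root, which comes first or last according to the first letter.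
    Classically this is $h+2$ for the Coxeter number $h$. *)
Definition turn : nat := (len (Ordinal n_gt0)).+3.

Lemma turnE i : turn = (len i).+3.
Proof. by rewrite /turn (len_const _ i). Qed.

Lemma star_sign i : eps (star i) = eps i (+) odd turn.
Proof. by have [_ -> _] := exitsP i; rewrite (turnE i) /= negbK addNb addbN. Qed.

Lemma star_inj : injective star.
Proof.
move=> i j ij; have eij : eps i = eps j.
  by apply: (@addIb (odd turn)); rewrite -!star_sign ij.
have [_ _ Ei] := exitsP i; have [_ _] := exitsP j.
rewrite -ij -Ei eij (len_const j i) => /(alternate_inj (tauJK setT)) /al_inj ->.
by [].
Qed.

(** As all [len] agree, [neighbor_exit] turns the left side of the mesh relation of [j] into a
    combination of the [al (star l)]; coordinates are compared at [star i]. *)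
Lemma star_cartan i j : cartan_mx dot Pi (star i) (star j) = cartan_mx dot Pi i j.
Proof.
have [->|ij] := eqVneq i j; first by rewrite !mxE !cartan_diag ?al_neq0.
have := congr1 (fun v => c (star i) v) (mesh_relation (exitsP j)).
rewrite !linear_sum /= (bigD1 i) //= [in RHS](bigD1 (star i)) ?(inj_eq star_inj) //=.
rewrite !linearZ /= coord_al eqxx mulr1 [X in _ = _ + X]big1 => [|l /andP[_ li]]; last first.
  by rewrite linearZ /= coord_al (negbTE li) mulr0.
have step l : l != j ->
    cartan_mx dot Pi l j *: alternate (trefl setT) (eps j) (len j) (al l) =
    cartan_mx dot Pi l j *: al (star l).
  move=> lj; have [->|alj] := eqVneq (cartan_mx dot Pi l j) 0; first by rewrite !scale0r.
  have [k _ _|_ ->//] := neighbor_exit lj alj; by rewrite (len_const j k).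
rewrite -linearZ /= step // big1 => [|l /andP[lj li]]; last first.
  by rewrite step // linearZ /= coord_al (inj_eq star_inj) (negbTE li) mulr0.
by rewrite linearZ /= coord_al eqxx mulr1 !addr0.
Qed.

(** * The linear map induced by the diagram automorphism *)

Definition twist v : V := \sum_(i < n) c i v *: al (star i).

Lemma twist_is_linear : linear twist.
Proof.
move=> r u v; rewrite /twist scaler_sumr -big_split /=; apply: eq_bigr => i _.
by rewrite linearD linearZ /= scalerDl scalerA.
Qed.
HB.instance Definition _ := GRing.isLinear.Build R V V _ twist twist_is_linear.

Lemma twist_al i : twist (al i) = al (star i).
Proof.
rewrite /twist (bigD1 i) //= coord_al eqxx scale1r big1 ?addr0 // => j ji.
by rewrite coord_al eq_sym (negbTE ji) scale0r.
Qed.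

Lemma twist_coord i v : c (star i) (twist v) = c i v.
Proof.
rewrite /twist linear_sum (bigD1 i) //= linearZ /= coord_al eqxx mulr1 big1 ?addr0 // => j ji.
by rewrite linearZ /= coord_al (inj_eq star_inj) (negbTE ji) mulr0.
Qed.

Lemma star_surj k : exists i, k = star i.
Proof. by exists (invF star_inj k); rewrite f_invF. Qed.

Lemma twist_inj : injective twist.
Proof. by move=> u v uv; apply: coord_ext => i; rewrite -!(twist_coord i) uv. Qed.

Lemma twist_tau e v : twist (tauJ setT e v) = tauJ setT (e (+) odd turn) (twist v).
Proof.
apply: coord_ext => k; have [{}k ->] := star_surj k.
rewrite twist_coord !tauJ_coord !in_setT /= star_sign.
rewrite (inj_eq (@addIb _)) twist_coord; case: ifP => // _.
congr (_ - _); rewrite [RHS](reindex_inj star_inj) /=.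
apply: eq_big => [l|l _]; first by rewrite (inj_eq star_inj).
by rewrite star_cartan twist_coord.
Qed.

Lemma evol_twist e t v : twist (evol e t v) = evol (e (+) odd turn) t (twist v).
Proof. by apply: alternate_morph => e' u; exact: twist_tau. Qed.

Lemma evol_opp_al i t : evol (~~ eps i) t.+2 (- al i) = evol (~~ eps i) t (al i).
Proof.
have fix_i : tauJ setT (~~ eps i) (- al i) = - al i.
  by rewrite tauJ_opp_al in_setT; case: (eps i).
by rewrite /= !negbK fix_i tauJ_opp_al in_setT eqxx.
Qed.

Lemma evol_turn_al e i : evol e turn (- al i) = twist (- al i).
Proof.
have -> : twist (- al i) = - al (star i) by rewrite linearN /= twist_al.
have last : evol (~~ eps i) (len i).+1 (al i) = - al (star i).
  by have [_ ei Ei] := exitsP i; rewrite alternateS Ei tauJ_al.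
have [ei|ei] := eqVneq (eps i) e; last first.
  have -> : e = ~~ eps i by case: (e) (eps i) ei => [] [].
  by rewrite (turnE i) evol_opp_al.
rewrite -ei (turnE i) alternateS.
have -> : evol (eps i) (len i).+2 (- al i) = - al (star i).
  by rewrite -last [LHS]/= tauJ_opp_al in_setT eqxx.
rewrite tauJ_opp_al in_setT /= star_sign (turnE i) /= !negbK.
by case: (eps i) (odd _) => [] [].
Qed.

Lemma evol_turn e v : evol e turn v = twist v.
Proof.
have opp i e' : evol e' turn (- al i) = twist (- al i) by exact: evol_turn_al.
have pos g : apos setT g -> evol e turn g = twist g.
  case=> [gP|[i _ -> //]]; have [s [i [_ _ ei Es]]] := posr_exit e gP.
  have Es1 : evol e s.+1 g = - al i by rewrite alternateS Es tauJ_al.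
  (* Append [s.+1] steps to both sides: exchanging the two words on the left gives a full turn
     applied to [- al i], which is known. *)
  apply: (alternate_inj (tauJK setT) (e := e (+) odd turn) (t := s.+1)).
  by rewrite -alternateD addnC alternateD Es1 opp -evol_twist Es1.
have [s sC ->] := cluster_expansion (v := v) (J := setT) (supported_setT v).
have [-> _] := alternate_combination e turn sC.
rewrite /combination linear_sum big_map; apply: eq_big_seq => p ps.
rewrite [RHS]linearZ -[X in _ = _ *: X]/(twist p.2) -pos //.
by case: (proj1 sC p ps).
Qed.

Lemma evolS_turn e t v : evol e (t + turn) v = twist (evol e t v).
Proof. by rewrite alternateD evol_turn. Qed.

(* tau is additive on a pair of almost positive roots unless the step is bad for
   one of them. *)
Definition bad e t g : bool :=
  [exists k, (evol e t g == - al k) && (eps k != e (+) odd t)].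

Lemma badP e t g : reflect
  (exists2 k, evol e t g = - al k & eps k = ~~ (e (+) odd t)) (bad e t g).
Proof.
apply: (iffP existsP) => [[k /andP[/eqP E ek]]|[k E ek]].
  by exists k => //; exact: neq_negb.
by exists k; rewrite E ek eqxx; case: (e (+) odd t).
Qed.

Lemma bad_turn e t g : bad e (t + turn) g = bad e t g.
Proof.
rewrite /bad evolS_turn oddD addbA.
apply/existsP/existsP => -[k /andP[/eqP E ek]].
  have [i ki] := star_surj k; exists i; rewrite ki star_sign (inj_eq (@addIb _)) in ek.
  by rewrite ek andbT; apply/eqP/twist_inj; rewrite E ki linearN /= twist_al.
by exists (star k); rewrite star_sign (inj_eq (@addIb _)) ek andbT E linearN /= twist_al.
Qed.

Lemma bad_modn e t g : bad e (t %% turn) g = bad e t g.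
Proof.
rewrite {2}(divn_eq t turn) addnC; elim: (t %/ turn)%N => [|q IHq]; first by rewrite addn0.
by rewrite mulSn addnCA addnC bad_turn.
Qed.

(** A bad step fixes [- al k], the next one gives [al k], and the orbit then stays positive for
    [len k] steps, so no bad step recurs before [turn] steps have passed. *)
Lemma bad_unique e s t g : bad e s g -> bad e t g -> (s < t)%N -> (t < s + turn)%N -> False.
Proof.
case/badP => k Es es /badP[l El el] st tt.
pose m := (t - s).-1; have tE : t = (s + m.+1)%N by rewrite /m; lia.
have mt : (m < turn.-1)%N by rewrite /m; lia.
move: El el; rewrite tE alternateD Es -[_ (+) odd s]negbK -es.
case: m {tE} mt => [_|m mt].
  have -> : evol (~~ eps k) 1 (- al k) = - al k.
    by rewrite [LHS]/= tauJ_opp_al in_setT; case: (eps k).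
  move=> /oppr_inj/al_inj <-; rewrite oddD addbA -[_ (+) odd s]negbK -es.
  by case: (eps k).
rewrite evol_opp_al => E _; have [pos _ _] := exitsP k.
have [_ + _] : posr setT (evol (~~ eps k) m (al k)).
  by apply: pos; rewrite (turnE k) in mt.
by rewrite E nonneg_opp_al.
Qed.

(** A positive root leaves through some [al k], and the resulting [- al k] meets the letter other
    than [eps k]. Periodicity brings the time below [turn]. *)
Lemma bad_exists e g : apos setT g -> exists2 t, (t < turn)%N & bad e t g.
Proof.
move=> gP; suff [t bt] : exists t, bad e t g.
  by exists (t %% turn)%N; rewrite ?ltn_mod // bad_modn.
have pos e' g' : posr setT g' -> exists t, bad e' t g'.
  case/(posr_exit e') => t [k [_ _ ek Ek]]; exists t.+1; apply/badP; exists k.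
    by rewrite alternateS Ek tauJ_al.
  by rewrite ek /= addbN negbK.
case: gP => [|[i _ gi]]; first exact: pos.
have [ei|ei] := eqVneq (eps i) e; last by exists 0; apply/existsP; exists i; rewrite gi eqxx addbF.
have [t] := pos (~~ e) _ (posr_al (in_setT i)); exists t.+1.
by rewrite /bad /= gi tauJ_opp_al in_setT ei eqxx addbN -addNb.
Qed.

(** Only positive parts of coordinates of sign other than [e] enter, and such a coordinate of an
    almost positive root is negative only at a bad step. *)
Lemma tau_additive e g b : apos setT g -> apos setT b -> ~~ bad e 0 g -> ~~ bad e 0 b ->
  tauJ setT e (g + b) = tauJ setT e g + tauJ setT e b.
Proof.
move=> gP bP gb bb; apply: coord_ext => k; rewrite [RHS]linearD /= !tauJ_coord.
case: ifP => [/andP[_ /eqP ek]|_]; last by rewrite linearD.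
suff -> : \sum_(j < n | j != k) cartan_mx dot Pi k j * Num.max (c j (g + b)) 0 =
    \sum_(j < n | j != k) cartan_mx dot Pi k j * Num.max (c j g) 0 +
    \sum_(j < n | j != k) cartan_mx dot Pi k j * Num.max (c j b) 0.
  by rewrite linearD /=; ring.
rewrite -big_split /=; apply: eq_bigr => j jk; rewrite linearD /=.
rewrite -mulrDr; have [->|akj] := eqVneq (cartan_mx dot Pi k j) 0; first by rewrite !mul0r.
have ej : eps j != e by rewrite -ek eq_sym (heps _ akj) // eq_sym.
have ge0 x : apos setT x -> ~~ bad e 0 x -> 0 <= c j x.
  move=> xP xb; apply: apos_coord_ge0 xP _; apply: contra xb => /eqP ->.
  by apply/existsP; exists j; rewrite eqxx addbF.
by rewrite !max_l ?addr_ge0 ?ge0.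
Qed.

Lemma bad_shift e t g : bad (e (+) odd t) 0 (evol e t g) = bad e t g.
Proof. by rewrite /bad addbF. Qed.

Lemma tau_opp_al_fixed j : tauJ setT (~~ eps j) (- al j) = - al j.
Proof. by rewrite tauJ_opp_al in_setT; case: (eps j). Qed.

(** Subtracting [al j] lowers the positive part of coordinate [j] from 1 to 0, which adds the entry
    at [(k, j)] to each coordinate [k] of sign [~~ eps j]. *)
Lemma tau_jump j x : c j x = 1 ->
  tauJ setT (~~ eps j) (- al j + tauJ setT (~~ eps j) x) =
  x - al j + \sum_(i < n | i != j) cartan_mx dot Pi i j *: al i.
Proof.
move=> xj; have : c j (tauJ setT (~~ eps j) x) = 1.
  by rewrite tauJ_coord in_setT; case: (eps j).
move: (tauJ _ _ x) (tauJK setT (~~ eps j) x) => y <- yj.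
apply: coord_ext => k.
rewrite !linearD linearN /= (coord_sum_cond (fun i => i != j)) !tauJ_coord in_setT.
rewrite linearD linearN /= coord_al; case: eqVneq => [ek|ek] /=; last first.
  have {}ek : eps k = eps j by case: (eps k) (eps j) ek => [] [].
  have [->|kj] := eqVneq k j; first by rewrite /= addr0 addrC.
  by rewrite mxE ca_same //= addr0 addrC.
have kj : k != j by apply/eqP => kj; move: ek; rewrite kj; case: (eps j).
rewrite kj eq_sym (negbTE kj) oppr0 add0r addr0.
rewrite [X in _ - X](bigD1 j) 1?eq_sym //= [X in _ = _ - X + _](bigD1 j) 1?eq_sym //=.
have -> : c j (- al j + y) = 0 by rewrite linearD linearN /= coord_al eqxx yj addNr.
rewrite yj (max_l ler01) (max_l (lexx 0)) mulr0 mulr1.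
rewrite [X in _ = _ - (_ + X) + _](eq_bigr (fun l =>
  cartan_mx dot Pi k l * Num.max (c l (- al j + y)) 0)).
  by ring.
move=> l /andP[_ lj]; rewrite linearD linearN /= coord_al eq_sym (negbTE lj).
by rewrite oppr0 add0r.
Qed.

Hypothesis n_gt1 : (1 < n)%N.

(** An isolated vertex would be a whole component; [n_gt1] excludes this. *)
Lemma simple_neighbor j : exists2 i, i != j & cartan_mx dot Pi i j != 0.
Proof.
have [/existsP[i /andP[]]|/existsPn H] := boolP [exists i, (i != j) && (cartan_mx dot Pi i j != 0)].
  by exists i.
have all_j : forall i, i == j.
  apply: (simple_connected (S := pred1 j) (i0 := j)) => /= [|i k /eqP -> kj]; first exact: eqxx.
  by have := H k; rewrite kj negbK mxE cartan_eq0 ?al_neq0 // dotC => /eqP.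
have := eqP (all_j (Ordinal n_gt0)); have := eqP (all_j (Ordinal n_gt1)) => <-.
by move/(congr1 val).
Qed.

(** * The set E *)

(* sigma (sigma^-1 a + sigma^-1 a') where sigma^-1 is the alternating word of
   length t whose first letter is tau_e. *)
Definition mixed e t a a' : V :=
  alternate (tauJ setT) (e (+) ~~ odd t) t (evol e t a + evol e t a').

Lemma evol_mixed e t a a' : evol e t (mixed e t a a') = evol e t a + evol e t a'.
Proof. exact: (alternateKV (tauJK setT)). Qed.

Lemma mixed_unique e t a a' x : evol e t x = evol e t a + evol e t a' -> x = mixed e t a a'.
Proof. by rewrite -evol_mixed => /(alternate_inj (tauJK setT)). Qed.

Lemma mixed0 e a a' : mixed e 0 a a' = a + a'.
Proof. by []. Qed.

Lemma mixed_turn e t a a' : mixed e (t + turn) a a' = mixed e t a a'.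
Proof. by apply/esym/mixed_unique; rewrite !evolS_turn evol_mixed linearD. Qed.

Lemma mixed_modn e t a a' : mixed e (t %% turn) a a' = mixed e t a a'.
Proof.
rewrite {2}(divn_eq t turn) addnC; elim: (t %/ turn)%N => [|q IHq]; first by rewrite addn0.
by rewrite mulSn addnCA addnC mixed_turn.
Qed.

Section Pair.

Variables (e : bool) (a a' : V).
Hypotheses (aP : apos setT a) (aP' : apos setT a').

Lemma mixedS t : ~~ bad e t a -> ~~ bad e t a' -> mixed e t.+1 a a' = mixed e t a a'.
Proof.
move=> ba ba'; apply/esym/mixed_unique; rewrite !alternateS evol_mixed.
by rewrite tau_additive ?bad_shift //; exact: apos_alternate.
Qed.

Lemma mixed_const s t : (s <= t)%N ->
  (forall m, (s <= m < t)%N -> ~~ bad e m a && ~~ bad e m a') ->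
  mixed e t a a' = mixed e s a a'.
Proof.
elim: t => [|t IHt]; first by rewrite leqn0 => /eqP ->.
rewrite leq_eqVlt ltnS => /predU1P[-> //|st] good.
have /andP[g g'] : ~~ bad e t a && ~~ bad e t a' by apply: good; rewrite st ltnSn.
rewrite mixedS // IHt // => m /andP[sm mt]; apply: good.
by rewrite sm ltnW.
Qed.

(** The two bad times cut a period into arcs on which [mixed] is constant; the arcs up to [sa] and
    after [sb] join across the end of the period. *)
Lemma mixed_values sa sb t : (sa < sb)%N -> (sb < turn)%N ->
    bad e sa a -> bad e sb a' ->
  mixed e t a a' = a + a' \/ mixed e t a a' = mixed e sa.+1 a a'.
Proof.
move=> sab sbH ba ba'; have lt0 : (0 < turn)%N by [].
have only_a m : (m < turn)%N -> m != sa -> ~~ bad e m a.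
  move=> mH ms; apply/negP => bm.
  case: (ltngtP m sa) ms => // lt _; [apply: (bad_unique bm ba) | apply: (bad_unique ba bm)]; lia.
have only_a' m : (m < turn)%N -> m != sb -> ~~ bad e m a'.
  move=> mH ms; apply/negP => bm.
  case: (ltngtP m sb) ms => // lt _; [apply: (bad_unique bm ba') | apply: (bad_unique ba' bm)]; lia.
rewrite -mixed_modn; have := ltn_pmod t lt0; move: (t %% turn)%N => m mH.
case: (leqP m sa) => [ms|sm].
  left; rewrite -(mixed0 e); apply: mixed_const => // l lm.
  by rewrite only_a ?only_a' //; lia.
case: (leqP m sb) => [ms|ms].
  right; apply: mixed_const => // l lm.
  by rewrite only_a ?only_a' //; lia.
left; rewrite -(mixed0 e) -(mixed_turn e 0); apply/esym; apply: mixed_const => [|l lm].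
  by rewrite add0n ltnW.
by rewrite only_a ?only_a' //; lia.
Qed.

Lemma mixed_jump t j : evol e t a = - al j -> eps j = ~~ (e (+) odd t) ->
    c j (evol e t a') = 1 ->
  evol e t (mixed e t.+1 a a') =
  evol e t a' - al j + \sum_(i < n | i != j) cartan_mx dot Pi i j *: al i.
Proof.
move=> Ea ej cj; apply: (can_inj (tauJK setT (e (+) odd t))).
rewrite -alternateS evol_mixed !alternateS Ea -[e (+) odd t]negbK -ej.
by rewrite tau_opp_al_fixed -tau_jump // tauJK.
Qed.

(** Transported to time [t], the two values differ by a combination of neighbours of [j], nonzero
    because [j] has one. *)
Lemma mixed_neq t j : evol e t a = - al j -> eps j = ~~ (e (+) odd t) ->
  c j (evol e t a') = 1 -> mixed e t.+1 a a' != mixed e t a a'.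
Proof.
move=> Ea ej cj; apply/eqP => /(congr1 (evol e t)).
rewrite (mixed_jump Ea ej cj) evol_mixed Ea [- _ + _]addrC -[RHS]addr0 => /addrI sum0.
have [i ij] := simple_neighbor j; have := congr1 (fun v => c i v) sum0.
by rewrite (coord_sum_cond (fun i => i != j)) ij linear0 => ->; rewrite eqxx.
Qed.

End Pair.

(** * Integrality of coordinates *)

Definition integral_coords v : Prop := forall i, exists z : int, c i v = z%:~R.

Lemma integral_coordsP v : integral_coords v <-> in_root_lattice Pi v.
Proof.
split=> [vZ|[f ->] i]; last first.
  exists (f i); rewrite (eq_bigr (fun k => (f k)%:~R *: al k)) ?coordE // => k _.
  by rewrite scaler_int.
have [f fE] := fin_all_exists vZ; exists f; rewrite {1}(coordK v).
by apply: eq_bigr => i _; rewrite fE scaler_int.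
Qed.

Lemma integral_coordsD u v : integral_coords u -> integral_coords v -> integral_coords (u + v).
Proof.
move=> uZ vZ i; have [z E] := uZ i; have [z' E'] := vZ i.
by exists (z + z'); rewrite linearD /= E E' rmorphD.
Qed.

Lemma integral_coords_tau J e v : integral_coords v -> integral_coords (tauJ J e v).
Proof.
move=> vZ i; rewrite tauJ_coord; case: ifP => _; last exact: vZ.
have [z ->] := vZ i.
have [s ->] : exists s : int,
    \sum_(j < n | j != i) cartan_mx dot Pi i j * Num.max (c j v) 0 = s%:~R.
  apply: (big_ind (fun x => exists s : int, x = s%:~R)) => [|x y [p ->] [q ->]|j _].
    by exists 0.
    by exists (p + q); rewrite rmorphD.
  have [p ->] := vZ j; have [q E] := roots_crystallographic hPhi (al_root i) (al_root j).
  exists (q * Num.max p 0); rewrite mxE E rmorphM /=; congr (_ * _).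
  by case: (leP 0 p) => p0; [rewrite max_l ?ler0z | rewrite max_r ?lerz0 ?ltW].
by exists (- z - s); rewrite rmorphB rmorphN.
Qed.

Lemma integral_coords_evol e t v : integral_coords v -> integral_coords (evol e t v).
Proof. by apply: (alternate_ind (P := integral_coords)) => e' u; exact: integral_coords_tau. Qed.

Lemma integral_coords_apos g : apos setT g -> integral_coords g.
Proof.
case=> [[gP _ _]|[k _ ->]] i; last first.
  by exists (- (k == i)%:R); rewrite linearN /= coord_al rmorphN /= natz.
have [f] := simple_decomposition hPi gP.
have E : c i (\sum_(k < n) al k *+ f k) = (f i)%:R.
  by under eq_bigr do rewrite -scaler_nat; rewrite coordE.
by case=> ->; [exists (f i) | exists (- (f i)%:Z)]; rewrite ?linearN /= E ?rmorphN.
Qed.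

(** * Periodicity and the group generated by the two involutions *)

Lemma iter_twist_al q i : iter q twist (al i) = al (iter q star i).
Proof. by elim: q => //= q ->; rewrite twist_al. Qed.

(** [star] is a permutation, so [twist] has finite order. Doubling makes the period even, so that
    its last letter is [~~ e]. *)
Lemma evol_period e : exists2 M, (0 < M)%N & ~~ odd M /\ forall v, evol e M v = v.
Proof.
pose N := #[perm star_inj]%g; have N0 : (0 < N)%N by exact: order_gt0.
have evol_iter q e' v : evol e' (q * turn) v = iter q twist v.
  elim: q => // q IHq; by rewrite mulSn addnC evolS_turn IHq.
have iterN v : iter N twist v = v.
  rewrite {1}(coordK v) iter_linear_sum {2}(coordK v); apply: eq_bigr => i _.
  rewrite iter_twist_al; congr (_ *: al _).
  have -> : iter N star i = iter N (perm star_inj) i by apply: eq_iter => j; rewrite permE.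
  by rewrite -permX expg_order perm1.
exists (N * turn).*2; first by rewrite double_gt0 muln_gt0 N0.
split=> [|v]; first by rewrite odd_double.
by rewrite -addnn alternateD !evol_iter !iterN.
Qed.

Lemma generated_evol e s : generated (tau dot Pi eps) s -> exists t, s =1 evol e t.
Proof.
have [M M0 [Me MK]] := evol_period e.
have closed e' t : exists t', forall v, tauJ setT e' (evol e t v) = evol e t' v.
  have [->|] := eqVneq e' (e (+) odd t); first by exists t.+1 => v; rewrite alternateS.
  move=> /neq_negb ->; case: t => [|t].
    (* The letter [~~ e] ends a full period; being an involution, it equals the word of length
       [M.-1]. *)
    exists M.-1 => v; rewrite -{1}(MK v) -{1}(prednK M0) alternateS.
    have -> : odd M.-1 = true by move: Me; rewrite -{1}(prednK M0) /= negbK.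
    by rewrite addbF addbT tauJK.
  by exists t => v; rewrite alternateS /= addbN negbK tauJK.
(* Words have an explicit inverse, their reversal, which handles [generated_inv]. *)
pose word (w : seq bool) v := foldr (tauJ setT) v w.
have word_evol w : exists t, word w =1 evol e t.
  elim: w => [|e' w [t IHw]]; first by exists 0%N.
  by have [t' H] := closed e' t; exists t' => v; rewrite -H -IHw.
have word_rev w v : word (rev w) (word w v) = v.
  elim: w v => // e' w IHw v; rewrite rev_cons -cats1 /word foldr_cat /= tauJK.
  exact: IHw.
move=> gs; suff [w sw] : exists w, s =1 word w.
  by have [t wt] := word_evol w; exists t => v; rewrite sw wt.
elim: {s} gs => [e'||s s' _ [w sw] _ [w' sw']|s s' _ [w sw] ss' s's].
- by exists [:: e'] => v; rewrite tau_setT.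
- by exists [::].
- by exists (w ++ w') => v /=; rewrite sw' sw /word foldr_cat.
- by exists (rev w) => v; rewrite -[LHS](word_rev w) -sw s's.
Qed.

Lemma generated_alternate e t : generated (tau dot Pi eps) (alternate (tau dot Pi eps) e t).
Proof.
elim: t e => [|t IHt] e; first exact: generated_id.
exact: (generated_comp (IHt (~~ e)) (generated_gen _ e)).
Qed.

Lemma E_setP e a a' x : E_set dot Pi eps a a' x <-> exists t, x = mixed e t a a'.
Proof.
split=> [[s [s' [gs ss' s's ->]]]|[t ->]].
  have [t s't] := generated_evol e (generated_inv gs ss' s's).
  by exists t; apply: mixed_unique; rewrite -!s't ss'.
have altE e' r v : alternate (tau dot Pi eps) e' r v = evol e' r v.
  by elim: r e' v => //= r IHr e' v; rewrite tau_setT IHr.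
exists (alternate (tau dot Pi eps) (e (+) ~~ odd t) t), (alternate (tau dot Pi eps) e t).
split=> [|v|v|]; first exact: generated_alternate.
- by rewrite !altE (alternateKV (tauJK setT)).
- by rewrite !altE (alternateK (tauJK setT)).
- by rewrite !altE.
Qed.

Lemma is_boxplus_mixed e a a' sa sb :
    apos setT a -> apos setT a' ->
    (forall t j, evol e t a = - al j -> c j (evol e t a') = 1) ->
    bad e sa a -> bad e sb a' -> (sa < sb)%N -> (sb < turn)%N ->
  is_boxplus dot Pi eps a a' (mixed e sa.+1 a a').
Proof.
move=> aP aP' deg ba ba' sab sbH.
have values t := mixed_values aP aP' t sab sbH ba ba'.
(* Otherwise the values at [sa] and [sa.+1] would agree, against [mixed_neq]. *)
have at_sa : mixed e sa a a' = a + a'.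
  have [//|E] := values sa; case/badP: ba => j Ej ej.
  by have /eqP := mixed_neq Ej ej (deg _ _ Ej); rewrite E.
have aZ : integral_coords (a + a') by apply: integral_coordsD; exact: integral_coords_apos.
split.
- case/badP: ba => j Ej ej; rewrite -[X in _ != X]at_sa.
  exact: mixed_neq Ej ej (deg _ _ Ej).
- exact/integral_coordsP.
- apply/integral_coordsP/integral_coords_evol/integral_coordsD;
    by apply: integral_coords_evol; exact: integral_coords_apos.
- move=> x; split=> [/(E_setP e)[t ->]|]; first exact: values.
  case=> ->; apply/(E_setP e); last by exists sa.+1.
  by exists 0%N.
Qed.

(** * The compatibility degree along orbits *)

Section CompatibilityDegree.

Variable d : V -> V -> nat.
Hypothesis hd : compatibility_degree dot Phi Pi eps d.

Lemma almost_positiveP g : almost_positive Phi Pi g <-> apos setT g.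
Proof.
split=> [[[gP g0]|[i ->]]|[[gP /nonnegP g0 _]|[i _ ->]]].
- by left; split=> //; [apply/nonnegP | exact: supported_setT].
- by right; exists i.
- by left.
- by right; exists i.
Qed.

Lemma degree_evol e t a a' : apos setT a -> apos setT a' ->
  d (evol e t a) (evol e t a') = d a a'.
Proof.
elim: t e a a' => // t IHt e a a' aP aP' /=.
rewrite IHt; [|exact: apos_tau..].
by rewrite -!tau_setT (compat_tau hd) //; exact/almost_positiveP.
Qed.

(** The degree stays 1 when both roots move together; once the first is negative simple, the degree
    is the positive part of a coordinate of the second. *)
Lemma degree1_coord e a a' : apos setT a -> apos setT a' -> d a a' = 1%N ->
  forall t j, evol e t a = - al j -> c j (evol e t a') = 1.
Proof.
move=> aP aP' daa' t j Ea; have aP't := apos_alternate e t aP'.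
have := compat_initial hd j (proj2 (almost_positiveP _) aP't).
by rewrite -Ea degree_evol // daa'; case: leP => // _ /eqP; rewrite oner_eq0.
Qed.

End CompatibilityDegree.
End Roots.

(** * Symmetry in the two roots, and conclusion *)

Lemma is_boxplusC (R : realFieldType) (V : vectType R) (dot : {dot V for idfun})
    (n : nat) (Pi : n.-tuple V) (eps : 'I_n -> bool) (a a' b : V) :
  is_boxplus dot Pi eps a a' b -> is_boxplus dot Pi eps a' a b.
Proof.
case=> ba aZ bZ Eab; split=> //; rewrite 1?addrC // => x.
apply: (iff_trans _ (Eab x)).
by split=> -[s [t [gs st ts ->]]]; exists s, t; split=> //; rewrite addrC.
Qed.

Theorem theorem1p14 (R : realFieldType) (V : vectType R)
    (dot : {dot V for idfun}) (n : nat) (Phi : seq V) (Pi : n.-tuple V)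
    (eps : 'I_n -> bool) (d : V -> V -> nat) (a a' : V)
    (hn : (1 < n)%N)
    (hPhi : root_system dot Phi)
    (hirr : irreducible_roots dot Phi)
    (hPi : simple_system Phi Pi)
    (heps : bipartition dot Pi eps)
    (hd : compatibility_degree dot Phi Pi eps d)
    (ha : almost_positive Phi Pi a)
    (ha' : almost_positive Phi Pi a')
    (haa' : d a a' = 1%N)
    (ha'a : d a' a = 1%N) :
  (exists b : V, is_boxplus dot Pi eps a a' b) /\
  (forall j : 'I_n, a' = - Pi`_j ->
     let b := tau dot Pi eps (~~ eps j)
                (- Pi`_j + tau dot Pi eps (~~ eps j) a) in
     is_boxplus dot Pi eps (- Pi`_j) a b /\
     b = a - Pi`_j + \sum_(i < n | i != j) cartan_mx dot Pi i j *: Pi`_i).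
Proof.
have [exit exitP] := fin_all_exists (exits_exist hPhi hPi heps).
have n0 : (0 < n)%N := ltnW hn.
have /(almost_positiveP Phi Pi) aP := ha; have /(almost_positiveP Phi Pi) aP' := ha'.
have deg e := degree1_coord hPhi hPi heps hd (e := e) aP aP' haa'.
have deg' e := degree1_coord hPhi hPi heps hd (e := e) aP' aP ha'a.
have bad_at := bad_exists hPhi hPi heps hirr exitP n0.
have boxplus e x y s s' := is_boxplus_mixed hPhi hPi heps hirr exitP (n_gt0 := n0) hn
  (e := e) (a := x) (a' := y) (sa := s) (sb := s').
(* At a common bad time both roots would be negative simple, and the second could not have a
   coordinate equal to 1. *)
have distinct e s : bad dot Pi eps e s a -> ~~ bad dot Pi eps e s a'.
  case/badP => j Ej _; apply/negP => /badP[k Ek _].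
  by have := deg e s j Ej; rewrite Ek linearN /= (coord_al hPi); case: eqP => _ /=; lra.
split=> [|j a'j].
  have [s sH ba] := bad_at true a aP; have [s' sH' ba'] := bad_at true a' aP'.
  case: (ltngtP s s') => [lt|lt|ss'].
  - by exists (mixed dot Pi eps true s.+1 a a'); exact: boxplus aP aP' (deg true) ba ba' lt sH'.
  - exists (mixed dot Pi eps true s'.+1 a' a); apply: is_boxplusC.
    exact: boxplus aP' aP (deg' true) ba' ba lt sH.
  - by have := distinct _ _ ba; rewrite ss' ba'.
have [s sH ba] := bad_at (~~ eps j) a aP.
(* With first letter [~~ eps j] the bad step of [a'] occurs at time 0, so the second element of the
   set is [mixed] at time 1. *)
have bj : bad dot Pi eps (~~ eps j) 0 a'.
  by apply/badP; exists j; rewrite //= addbF negbK.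
have s0 : (0 < s)%N.
  by rewrite lt0n; apply: contraTneq bj => s0; apply: distinct; rewrite -s0.
have := boxplus _ _ _ _ _ aP' aP (deg' (~~ eps j)) bj ba s0 sH.
have -> : mixed dot Pi eps (~~ eps j) 1 a' a =
    tau dot Pi eps (~~ eps j) (- Pi`_j + tau dot Pi eps (~~ eps j) a).
  by rewrite !tau_setT a'j /mixed /= addbF (tau_opp_al_fixed dot eps hPi).
rewrite a'j => box; split=> //; rewrite !tau_setT; apply: (tau_jump hPhi hPi heps).
by apply: (deg' (~~ eps j) 0 j).
Qed.
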